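(* Let $(M,g,\phi,\xi,\eta)$ be a $(2n+1)$-dimensional Kenmotsu manifold and let $(g,V,\lambda,\mu)$ be a conformal $\eta$-Ricci soliton on $M$ with conformal pressure $p$. Then the soliton is shrinking if $\mu<2n+\left(\frac{p}{2}+\frac{1}{2n+1}\right)$, steady if $\mu=2n+\left(\frac{p}{2}+\frac{1}{2n+1}\right)$, and expanding if $\mu>2n+\left(\frac{p}{2}+\frac{1}{2n+1}\right)$.
   Context: An almost contact metric manifold $(M,g,\phi,\xi,\eta)$ of dimension $2n+1$ ($n\ge 1$) is a smooth Riemannian manifold $(M,g)$ with a $(1,1)$-tensor field $\phi$, a vector field $\xi$ and a 1-form $\eta$ such that $\phi^2=-I+\eta\otimes\xi$, $\eta(\xi)=1$, $\eta(X)=g(X,\xi)$ and $g(\phi X,\phi Y)=g(X,Y)-\eta(X)\eta(Y)$ for all vector fields $X,Y$. It is a Kenmotsu manifold if its Levi-Civita connection $\nabla$ satisfies $(\nabla_X\phi)Y=g(\phi X,Y)\xi-\eta(Y)\phi X$ for all $X,Y$. A conformal $\eta$-Ricci soliton $(g,V,\lambda,\mu)$ on a $(2n+1)$-dimensional almost contact metric manifold consists of a smooth vector field $V$ and real constants $\lambda,\mu$ such that $$\mathcal{L}_V g+2S+\left[2\lambda-\left(p+\tfrac{2}{2n+1}\right)\right]g+2\mu\,\eta\otimes\eta=0,$$ where $\mathcal{L}_V$ is the Lie derivative along $V$, $S$ is the Ricci tensor of $g$, and $p$ (the conformal pressure) is a scalar that is constant on $M$. The soliton is called shrinking if $\lambda>0$,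 steady if $\lambda=0$, and expanding if $\lambda<0$. *)

(* Defs.v *)
From HB Require Import structures.
From mathcomp Require Import all_boot all_order all_algebra.
From mathcomp Require Import all_classical all_reals all_analysis.

Set Implicit Arguments.
Unset Strict Implicit.
Unset Printing Implicit Defensive.

Import Order.TTheory GRing.Theory Num.Theory.
Import numFieldNormedType.Exports.

Local Open Scope classical_set_scope.
Local Open Scope ring_scope.

(* Tangent vectors in a chart are row vectors, and maps act on the right: with
   this convention the differential of f at x is u |-> u *m 'J f x. *)

Section SmoothMaps.
Context {R : realType} {m : nat} {W : normedModType R}.

(* C^k on U; only meant for open U, since f may be arbitrary outside U. *)
Fixpoint Ck_on (k : nat) (U : set 'rV[R]_m) (f : 'rV[R]_m -> W) : Prop :=
  if k is k'.+1 then
    (forall x, U x -> differentiable f x) /\ (forall v, Ck_on k' U ('D_v f))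
  else forall x, U x -> {for x, continuous f}.

Definition smooth_on (U : set 'rV[R]_m) (f : 'rV[R]_m -> W) : Prop :=
  forall k, Ck_on k U f.

End SmoothMaps.

(* chart_inv is only meaningful on chart_coord @` chart_dom. *)
Record chart (R : realType) (m : nat) (M : topologicalType) := Chart {
  chart_dom : set M ;
  chart_coord : M -> 'rV[R]_m ;
  chart_inv : 'rV[R]_m -> M ;
  chart_dom_open : open chart_dom ;
  chart_img_open : open (chart_coord @` chart_dom) ;
  chart_coordK : forall q, chart_dom q -> chart_inv (chart_coord q) = q ;
  chart_coord_continuous :
    forall q, chart_dom q -> {for q, continuous chart_coord} ;
  chart_inv_continuous : forall x, (chart_coord @` chart_dom) x ->
    {for x, continuous chart_inv} }.

Section Transition.
Context {R : realType} {m : nat} {M : topologicalType}.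
Implicit Types c d : chart R m M.

Definition chart_img c : set 'rV[R]_m := chart_coord c @` chart_dom c.

Definition overlap c d : set 'rV[R]_m :=
  chart_coord c @` (chart_dom c `&` chart_dom d).

Definition transition c d : 'rV[R]_m -> 'rV[R]_m :=
  chart_coord d \o chart_inv c.

End Transition.

Record smooth_manifold (R : realType) (m : nat) := SmoothManifold {
  mcarrier :> topologicalType ;
  manifold_nonempty : [set: mcarrier] !=set0 ;
  manifold_hausdorff : hausdorff_space mcarrier ;
  manifold_second_countable : @second_countable mcarrier ;
  atlas_index : Type ;
  atlas : atlas_index -> chart R m mcarrier ;
  atlas_cover : forall q : mcarrier, exists a, chart_dom (atlas a) q ;
  atlas_smooth : forall a b,
    smooth_on (overlap (atlas a) (atlas b)) (transition (atlas a) (atlas b)) }.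

(* A tensor field is given by smooth components in every chart of the atlas,
   related on overlaps by the Jacobian of the change of coordinates. *)
Section TensorFields.
Context {R : realType} {m : nat} (M : smooth_manifold R m).

Local Notation img a := (chart_img (atlas (s:=M) a)).
Local Notation ovl a b := (overlap (atlas (s:=M) a) (atlas b)).
Local Notation tau a b := (transition (atlas (s:=M) a) (atlas b)).

Record vector_field := VectorField {
  vf_comp :> atlas_index M -> 'rV[R]_m -> 'rV[R]_m ;
  vf_smooth : forall a, smooth_on (img a) (vf_comp a) ;
  vf_change : forall a b x, ovl a b x ->
    vf_comp b (tau a b x) = vf_comp a x *m 'J (tau a b) x }.

(* The value on the tangent vector u is u *m of_comp a x. *)
Record one_form := OneForm {
  of_comp :> atlas_index M -> 'rV[R]_m -> 'cV[R]_m ;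
  of_smooth : forall a, smooth_on (img a) (of_comp a) ;
  of_change : forall a b x, ovl a b x ->
    of_comp a x = 'J (tau a b) x *m of_comp b (tau a b x) }.

(* (1,1)-tensor fields; the image of the tangent vector u is u *m ef_comp a x. *)
Record endo_field := EndoField {
  ef_comp :> atlas_index M -> 'rV[R]_m -> 'M[R]_m ;
  ef_smooth : forall a, smooth_on (img a) (ef_comp a) ;
  ef_change : forall a b x, ovl a b x ->
    ef_comp a x *m 'J (tau a b) x = 'J (tau a b) x *m ef_comp b (tau a b x) }.

Record riemannian_metric := RiemannianMetric {
  rm_comp :> atlas_index M -> 'rV[R]_m -> 'M[R]_m ;
  rm_smooth : forall a, smooth_on (img a) (rm_comp a) ;
  rm_change : forall a b x, ovl a b x ->
    rm_comp a x =
      'J (tau a b) x *m rm_comp b (tau a b x) *m ('J (tau a b) x)^T ;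
  rm_sym : forall a x, img a x -> (rm_comp a x)^T = rm_comp a x ;
  rm_pos : forall a x, img a x ->
    forall u : 'rV[R]_m, u != 0 -> 0 < (u *m rm_comp a x *m u^T) 0 0 }.

End TensorFields.

Section PointwiseOperations.
Context {R : realType} {m : nat}.

Definition inner (G : 'M[R]_m) (u v : 'rV[R]_m) : R := (u *m G *m v^T) 0 0.

Definition pairing (w : 'cV[R]_m) (u : 'rV[R]_m) : R := (u *m w) 0 0.

End PointwiseOperations.

(* Riemannian geometry in a coordinate domain: G is the metric and X, Y, Z, V
   are vector fields, all as functions of the coordinates. *)
Section CoordinateDomain.
Context {R : realType} {m : nat}.
Variable G : 'rV[R]_m -> 'M[R]_m.
Implicit Types (X Y Z V : 'rV[R]_m -> 'rV[R]_m) (x : 'rV[R]_m) (i j k l : 'I_m).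

Definition coord_vec i : 'rV[R]_m := delta_mx 0 i.

Definition dmetric i j k x : R := 'D_(coord_vec i) (fun y => G y j k) x.

(* The vector with k-th entry
   Gamma^k_ij = 1/2 \sum_l (d_i g_jl + d_j g_il - d_l g_ij) g^lk. *)
Definition christoffel i j x : 'rV[R]_m :=
  2^-1 *: ((\row_l (dmetric i j l x + dmetric j i l x - dmetric l i j x))
            *m invmx (G x)).

(* Levi-Civita connection *)
Definition nabla X Y x : 'rV[R]_m :=
  'D_(X x) Y x + \sum_i \sum_j (X x 0 i * Y x 0 j) *: christoffel i j x.

Definition lie_bracket X Y x : 'rV[R]_m := 'D_(X x) Y x - 'D_(Y x) X x.

Definition curvature X Y Z x : 'rV[R]_m :=
  nabla X (nabla Y Z) x - nabla Y (nabla X Z) x - nabla (lie_bracket X Y) Z x.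

(* S(Y, Z) = trace of X |-> R(X, Y)Z *)
Definition ricci Y Z x : R :=
  \sum_i curvature (fun=> coord_vec i) Y Z x 0 i.

Definition lie_metric V X Y x : R :=
  'D_(V x) (fun y => inner (G y) (X y) (Y y)) x
  - inner (G x) (lie_bracket V X x) (Y x)
  - inner (G x) (X x) (lie_bracket V Y x).

(* (nabla_X phi) Y = nabla_X (phi Y) - phi (nabla_X Y) *)
Definition nabla_endo (F : 'rV[R]_m -> 'M[R]_m) X Y x : 'rV[R]_m :=
  nabla X (fun y => Y y *m F y) x - nabla X Y x *m F x.

End CoordinateDomain.

Section Kenmotsu.
Context {R : realType} {n : nat} {M : smooth_manifold R (2 * n).+1}.
Variables (g : riemannian_metric M) (phi : endo_field M) (xi : vector_field M)
  (eta : one_form M).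

Local Notation vec := ('rV[R]_(2 * n).+1).

Record almost_contact_metric : Prop := AlmostContactMetric {
  acm_phi2 : forall a x, chart_img (atlas (s:=M) a) x -> forall u : vec,
    u *m phi a x *m phi a x = - u + pairing (eta a x) u *: xi a x ;
  acm_eta_xi : forall a x, chart_img (atlas (s:=M) a) x ->
    pairing (eta a x) (xi a x) = 1 ;
  acm_eta : forall a x, chart_img (atlas (s:=M) a) x -> forall u : vec,
    pairing (eta a x) u = inner (g a x) u (xi a x) ;
  acm_compatible : forall a x, chart_img (atlas (s:=M) a) x ->
    forall u v : vec,
    inner (g a x) (u *m phi a x) (v *m phi a x) =
      inner (g a x) u v - pairing (eta a x) u * pairing (eta a x) v }.

(* Both sides of the identities below are tensorial in X and Y, so X and Y
   range over the smooth vector fields on each coordinate domain. *)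
Definition kenmotsu : Prop :=
  almost_contact_metric /\
  forall a (X Y : vec -> vec),
    smooth_on (chart_img (atlas (s:=M) a)) X ->
    smooth_on (chart_img (atlas (s:=M) a)) Y ->
    forall x, chart_img (atlas (s:=M) a) x ->
    nabla_endo (g a) (phi a) X Y x =
      inner (g a x) (X x *m phi a x) (Y x) *: xi a x
      - pairing (eta a x) (Y x) *: (X x *m phi a x).

Definition conformal_eta_ricci_soliton (V : vector_field M)
    (lambda mu p : R) : Prop :=
  forall a (X Y : vec -> vec),
    smooth_on (chart_img (atlas (s:=M) a)) X ->
    smooth_on (chart_img (atlas (s:=M) a)) Y ->
    forall x, chart_img (atlas (s:=M) a) x ->
    lie_metric (g a) (V a) X Y x + 2 * ricci (g a) X Y x
    + (2 * lambda - (p + 2 / (2 * n).+1%:R)) * inner (g a x) (X x) (Y x)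
    + 2 * mu * (pairing (eta a x) (X x) * pairing (eta a x) (Y x)) = 0.

End Kenmotsu.

Section SolitonType.
Context {R : realType}.
Implicit Type lambda : R.

Definition shrinking lambda : Prop := 0 < lambda.
Definition steady lambda : Prop := lambda = 0.
Definition expanding lambda : Prop := lambda < 0.

End SolitonType.

(* Main.v *)
Require Import Defs.
From HB Require Import structures.
From mathcomp Require Import all_boot all_order all_algebra.
From mathcomp Require Import all_classical all_reals all_analysis.
From mathcomp Require Import ring lra.
Import Order.TTheory GRing.Theory Num.Theory.
Import numFieldNormedType.Exports.
Local Open Scope classical_set_scope.
Local Open Scope ring_scope.

(* Put kappa = 2n + p/2 + 1/(2n+1) - lambda - mu; the claim is kappa = 0, and it
   is proved in a single chart.  A Kenmotsu metric satisfies
   nabla_X xi = X - eta(X) xi, hence S(xi, .) = -2n eta; contracting the second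
   Bianchi identity with xi also gives xi(r) = -2r - 4n(2n+1) for the scalar
   curvature r.  With f = eta(V), the soliton equation contracted once with xi
   yields xi(f) = kappa and
     [xi, V] = 2 kappa xi - grad f,   [xi, grad f] = 2 kappa xi - 2 grad f.
   As div xi = 2n is constant, xi(div X) = div [xi, X] for every X, so that
     xi(xi(div V)) = -2 xi(div V) + 4n kappa.
   The trace of the soliton equation says that div V + r is constant, while
   xi(xi(r)) = -2 xi(r): therefore 4n kappa = 0, and n > 0. *)

(** * Riemannian geometry over a ring with commuting derivations *)

(** Contracting the soliton equation twice with xi and using S(xi, xi) = -2n gives kappa as xi(f).
    As V is an arbitrary field, no further pointwise contraction forces kappa = 0: the contradiction
    comes from comparing two second-order equations along xi, an inhomogeneous one for div V and a
    homogeneous one for r. The second equation exists because R(., xi) is expressed by g and eta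
    alone, so that the second Bianchi identity gives nabla_xi R = -2 (R - R'), where R' is the
    curvature tensor of constant curvature -1. Its full trace is xi(r) = -2 (r + 2n(2n+1)). The
    tensor calculus runs over an abstract commutative ring with commuting derivations: no
    differentiability condition arises there, and matrix entries are settled by [ring]. The smooth
    functions on a chart are shown afterwards to form such a ring, and the resulting identity is
    evaluated at one point. *)

Lemma addmxE (F : comPzRingType) p q (A B : 'M[F]_(p, q)) i j :
  (A + B) i j = A i j + B i j.
Proof. by rewrite mxE. Qed.

Lemma oppmxE (F : comPzRingType) p q (A : 'M[F]_(p, q)) i j :
  (- A) i j = - A i j.
Proof. by rewrite mxE. Qed.

Lemma scalemxE (F : comPzRingType) p q (a : F) (A : 'M[F]_(p, q)) i j :
  (a *: A) i j = a * A i j.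
Proof. by rewrite mxE. Qed.

Lemma zeromxE (F : comPzRingType) p q i j : (0 : 'M[F]_(p, q)) i j = 0.
Proof. by rewrite mxE. Qed.

Lemma trmxD (F : comPzRingType) p q (A B : 'M[F]_(p, q)) :
  (A + B)^T = A^T + B^T.
Proof. by apply/matrixP => i j; rewrite !mxE. Qed.

Lemma trmxN (F : comPzRingType) p q (A : 'M[F]_(p, q)) : (- A)^T = - A^T.
Proof. by apply/matrixP => i j; rewrite !mxE. Qed.

Lemma mulNmxC (F : comPzRingType) p q r (A : 'M[F]_(p, q)) (B : 'M[F]_(q, r)) :
  - A *m B = - (A *m B).
Proof. exact: mulNmx. Qed.

Lemma mulmxNC (F : comPzRingType) p q r (A : 'M[F]_(p, q)) (B : 'M[F]_(q, r)) :
  A *m - B = - (A *m B).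
Proof. exact: mulmxN. Qed.

Lemma mulZmx (F : comPzRingType) p q r c (A : 'M[F]_(p, q)) (B : 'M[F]_(q, r)) :
  (c *: A) *m B = c *: (A *m B).
Proof. by rewrite scalemxAl. Qed.

Lemma mulmxZ (F : comPzRingType) p q r c (A : 'M[F]_(p, q)) (B : 'M[F]_(q, r)) :
  A *m (c *: B) = c *: (A *m B).
Proof. by rewrite scalemxAr. Qed.

Lemma trmxZ (F : comPzRingType) p q c (A : 'M[F]_(p, q)) :
  (c *: A)^T = c *: A^T.
Proof. by apply/matrixP => i j; rewrite !mxE. Qed.

(* The ring tactic compares atoms syntactically, including the structure
   instances inside mulmx: the rewrite rules are therefore the versions above,
   all stated over a comPzRingType. *)
Ltac mxdistr :=
  rewrite ?(mulmxDl, mulmxDr, mulmxNC, mulNmxC, mulmxA,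
    mulZmx, mulmxZ, trmxD, trmxN, trmxZ, trmx_mul, trmxK).

Ltac mxentries :=
  apply/matrixP => ? ?; rewrite ?(addmxE, oppmxE, scalemxE, zeromxE); ring.

(* F stands for the smooth functions on a coordinate domain, d for the partial
   derivatives; vector fields are row vectors over F. *)
Section DerivationRing.
Context {F : comPzRingType} {m : nat}.
Variable d : 'I_m -> F -> F.
Hypothesis dD : forall i a b, d i (a + b) = d i a + d i b.
Hypothesis dM : forall i a b, d i (a * b) = d i a * b + a * d i b.
Hypothesis dC : forall i j a, d i (d j a) = d j (d i a).

Lemma der0 i : d i 0 = 0.
Proof. by apply: (addrI (d i 0)); rewrite -dD !addr0. Qed.

Lemma derN i a : d i (- a) = - d i a.
Proof. by apply: (addrI (d i a)); rewrite -dD !subrr der0. Qed.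

Lemma derB i a b : d i (a - b) = d i a - d i b.
Proof. by rewrite dD derN. Qed.

Lemma der1 i : d i 1 = 0.
Proof.
by apply: (addrI (d i 1)); rewrite addr0 -{3}[1]mulr1 dM mulr1 mul1r.
Qed.

Lemma der_sum i I (r : seq I) (P : pred I) (f : I -> F) :
  d i (\sum_(j <- r | P j) f j) = \sum_(j <- r | P j) d i (f j).
Proof. exact: (big_morph (d i) (dD i) (der0 i)). Qed.

Lemma der_nat i k : d i k%:R = 0.
Proof. by elim: k => [|k IH];
  rewrite ?der0// -addn1 natrD dD IH der1 addr0. Qed.

Definition dmx i {p q} (A : 'M[F]_(p, q)) : 'M[F]_(p, q) := map_mx (d i) A.

Lemma dmxD i p q (A B : 'M[F]_(p, q)) : dmx i (A + B) = dmx i A + dmx i B.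
Proof. by apply/matrixP => a b; rewrite !mxE dD. Qed.

Lemma dmxN i p q (A : 'M[F]_(p, q)) : dmx i (- A) = - dmx i A.
Proof. by apply/matrixP => a b; rewrite !mxE derN. Qed.

Lemma dmx0 i p q : dmx i (0 : 'M[F]_(p, q)) = 0.
Proof. by apply/matrixP => a b; rewrite !mxE der0. Qed.

Lemma dmx_sum i p q I (r : seq I) (P : pred I) (f : I -> 'M[F]_(p, q)) :
  dmx i (\sum_(j <- r | P j) f j) = \sum_(j <- r | P j) dmx i (f j).
Proof. exact: (big_morph (dmx i) (dmxD i p q) (dmx0 i p q)). Qed.

Lemma dmxM i p q s (A : 'M[F]_(p, q)) (B : 'M[F]_(q, s)) :
  dmx i (A *m B) = dmx i A *m B + A *m dmx i B.
Proof.
apply/matrixP => a b; rewrite !mxE der_sum -big_split /=.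
by apply: eq_bigr => k _; rewrite !mxE dM.
Qed.

Lemma dmxZ i p q c (A : 'M[F]_(p, q)) : dmx i (c *: A) =
  d i c *: A + c *: dmx i A.
Proof. by apply/matrixP => a b; rewrite !mxE dM. Qed.

Lemma dmxT i p q (A : 'M[F]_(p, q)) : dmx i A^T = (dmx i A)^T.
Proof. by apply/matrixP => a b; rewrite !mxE. Qed.

Lemma dmxC i j p q (A : 'M[F]_(p, q)) : dmx i (dmx j A) = dmx j (dmx i A).
Proof. by apply/matrixP => a b; rewrite !mxE dC. Qed.

Lemma dmx_tr i p (A : 'M[F]_p) : \tr (dmx i A) = d i (\tr A).
Proof. by rewrite /mxtrace der_sum; apply: eq_bigr => k _; rewrite mxE. Qed.

Lemma dmx_delta i p q (a : 'I_p) (b : 'I_q) : dmx i (delta_mx a b) = 0.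
Proof. by apply/matrixP => u v; rewrite !mxE der_nat. Qed.

(** * Connections, curvature and the Bianchi identities *)

Section Connection.
Variable Gam : 'I_m -> 'M[F]_m.

Local Notation e j := (delta_mx (0 : 'I_1) j : 'rV[F]_m).

(** Row [j] of [Gam i] is the covariant derivative of e_j along e_i, so [Gam i j k] is the
    Christoffel symbol with upper index [k]. *)
Definition nab i (u : 'rV[F]_m) : 'rV[F]_m := dmx i u + u *m Gam i.

(** The commutator with [Gam i] accounts for the two indices of the endomorphism only; labels of
    [A], such as the form indices of [riem], are not differentiated covariantly. *)
Definition nab_end i (A : 'M[F]_m) : 'M[F]_m :=
  dmx i A + A *m Gam i - Gam i *m A.

(* u *m riem i j is R(e_i, e_j) u, as endomorphisms act on the right. *)
Definition riem i j : 'M[F]_m :=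
  dmx i (Gam j) - dmx j (Gam i) + Gam j *m Gam i - Gam i *m Gam j.

Lemma nabD i u v : nab i (u + v) = nab i u + nab i v.
Proof. by rewrite /nab dmxD mulmxDl addrACA. Qed.

Lemma nabN i u : nab i (- u) = - nab i u.
Proof. by rewrite /nab dmxN mulNmx opprD. Qed.

Lemma nabZ i c u : nab i (c *: u) = d i c *: u + c *: nab i u.
Proof. by rewrite /nab dmxZ -scalemxAl scalerDr addrA. Qed.

Lemma nab_delta i j : nab i (e j) = row j (Gam i).
Proof. by rewrite /nab dmx_delta add0r -rowE. Qed.

Lemma ricci_identity i j u :
  nab i (nab j u) - nab j (nab i u) = u *m riem i j.
Proof.
rewrite /nab /riem !dmxD !dmxM (dmxC j i); mxdistr.
mxentries.
Qed.

Lemma riemN i j : riem j i = - riem i j.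
Proof. rewrite /riem; mxentries. Qed.

Lemma nab_endN i A : nab_end i (- A) = - nab_end i A.
Proof. rewrite /nab_end dmxN; mxdistr; mxentries. Qed.

Lemma nab_endD i A B : nab_end i (A + B) = nab_end i A + nab_end i B.
Proof. rewrite /nab_end dmxD; mxdistr; mxentries. Qed.

Lemma nab_endZ i c A : nab_end i (c *: A) = d i c *: A + c *: nab_end i A.
Proof.
rewrite /nab_end dmxZ; mxdistr; mxentries.
Qed.

Lemma nab_end_sum i I (r : seq I) (P : pred I) (f : I -> 'M[F]_m) :
  nab_end i (\sum_(j <- r | P j) f j) = \sum_(j <- r | P j) nab_end i (f j).
Proof.
by rewrite /nab_end dmx_sum mulmx_suml mulmx_sumr -big_split -sumrB.
Qed.

(** The exterior covariant derivative of the curvature form vanishes: second derivatives cancel by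
    [dmxC], and the remaining products cancel in the cyclic sum. *)
Lemma bianchi2 i j k :
  nab_end k (riem i j) + nab_end i (riem j k) + nab_end j (riem k i) = 0.
Proof.
rewrite /nab_end /riem !(dmxD, dmxN, dmxM).
rewrite (dmxC k i) (dmxC k j) (dmxC i j); mxdistr.
mxentries.
Qed.

(** The commutator of connection matrices is traceless, which leaves the exterior derivative of the
    1-form [\tr (Gam k)]. *)
Lemma tr_riem i j : \tr (riem i j) = d i (\tr (Gam j)) - d j (\tr (Gam i)).
Proof.
by rewrite /riem !(mxtraceD, raddfN) /= !dmx_tr mxtrace_mulC addrK.
Qed.

Hypothesis torsion_free : forall i j, row j (Gam i) = row i (Gam j).

Lemma GamC i j k : Gam i j k = Gam j i k.
Proof. by have /rowP/(_ k) := torsion_free i j; rewrite !mxE. Qed.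

(** The Ricci identity on coordinate vectors produces six second derivatives, which cancel in pairs
    because nabla_i e_j = nabla_j e_i. *)
Lemma bianchi1 i j k : e k *m riem i j + e i *m riem j k + e j *m riem k i = 0.
Proof.
rewrite -!ricci_identity !nab_delta (torsion_free k i) (torsion_free k j).
rewrite (torsion_free j i); mxentries.
Qed.

(** * Metric connections and the symmetries of their curvature *)

Section Metric.
Variables G Gi : 'M[F]_m.
Hypothesis G_sym : G^T = G.
Hypothesis G_inv : G *m Gi = 1%:M.
Hypothesis nabG : forall i, dmx i G = Gam i *m G + G *m (Gam i)^T.
Hypothesis two_reg : forall a : F, a + a = 0 -> a = 0.

Lemma GC i j : G i j = G j i.
Proof. by rewrite -{1}G_sym mxE. Qed.

Lemma Gi_invl : Gi *m G = 1%:M.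
Proof. exact: mulmx1C. Qed.

Lemma Gi_sym : Gi^T = Gi.
Proof.
have E : Gi^T *m G = 1%:M by rewrite -{1}G_sym -trmx_mul G_inv trmx1.
by rewrite -[LHS]mulmx1 -G_inv mulmxA E mul1mx.
Qed.

Lemma mulG_inj p (A B : 'M[F]_(p, m)) : A *m G = B *m G -> A = B.
Proof. by move=> E; rewrite -[A]mulmx1 -[B]mulmx1 -G_inv !mulmxA E. Qed.

Lemma nab_inner i u v :
  dmx i (u *m G *m v^T) = nab i u *m G *m v^T + u *m G *m (nab i v)^T.
Proof.
rewrite /nab !dmxM nabG dmxT; mxdistr.
mxentries.
Qed.

(** Expanding both orders of two derivatives of [G] by [nabG], the difference is [riem i j *m G]
    plus its transpose. *)
Lemma riem_anti i j : (riem i j *m G)^T = - (riem i j *m G).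
Proof.
have := dmxC i j m m G; rewrite !nabG !(dmxD, dmxM, nabG, dmxT).
rewrite /riem; mxdistr; rewrite G_sym.
move/eqP; rewrite -subr_eq0 => /eqP E.
apply/eqP; rewrite -subr_eq0 -{}E; apply/eqP.
mxentries.
Qed.

Lemma riem_antiE i j a b : (riem i j *m G) b a = - (riem i j *m G) a b.
Proof. by have /matrixP/(_ a b) := riem_anti i j; rewrite !mxE. Qed.

Lemma bianchi1E i j k l :
  (riem i j *m G) k l + (riem j k *m G) i l + (riem k i *m G) j l = 0.
Proof.
have rowG A p : (A *m G) p l = (e p *m A *m G)
  0 l by rewrite -mulmxA -rowE [RHS]mxE.
by rewrite !rowG -!addmxE -!mulmxDl bianchi1 mul0mx zeromxE.
Qed.

Lemma riem_pair i j k l : (riem i j *m G) k l = (riem k l *m G) i j.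
Proof.
apply/eqP; rewrite -subr_eq0; apply/eqP/two_reg.
have skew a b c c' : (riem b a *m G) c c' = - (riem a b *m G) c c'.
  by rewrite riemN mulNmxC oppmxE.
have B1 := bianchi1E i j k l; have := bianchi1E j k l i.
have B3 := bianchi1E k l i j; have := bianchi1E l i j k.
rewrite (riem_antiE j k i l) (riem_antiE k l i j) (skew j l k i)
  (riem_antiE j l i k).
rewrite (skew i k) (riem_antiE i k l j) in B1.
rewrite (riem_antiE l i j k) in B3.
rewrite (riem_antiE i j k l) => B4 B2.
(* The combination B1 + B2 - B3 - B4 of the four cyclic identities: the skew symmetries leave twice
   the wanted difference. *)
transitivity (((riem i j *m G) k l + (riem j k *m G) i l +
  - - (riem i k *m G) l j)
  + (- (riem j k *m G) i l + - (riem k l *m G) i j + - - (riem j l *m G) i k)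
  - ((riem k l *m G) i j + - (riem l i *m G) j k + (riem i k *m G) l j)
  - ((riem l i *m G) j k + - (riem i j *m G) k l + (riem j l *m G) i k)).
  ring.
by rewrite B1 B2 B3 B4; ring.
Qed.

Definition gnab (u : 'rV[F]_m) : 'M[F]_m := \matrix_i nab i u.

Definition divg (u : 'rV[F]_m) : F := \tr (gnab u).

Lemma mul_gnab u v : v *m gnab u = \sum_k v 0 k *: nab k u.
Proof.
by rewrite mulmx_sum_row; apply: eq_bigr => k _; rewrite rowK.
Qed.

(** The left side is the coordinate formula of the Lie derivative of the metric. Metric
    compatibility splits the derivative of [G] into two Christoffel terms, and [GamC] attaches one
    to each derivative of [u]. *)
Lemma lie_metric_nab (u : 'rV[F]_m) i j :
  \sum_k u 0 k * d k (G i j) + (dmx i u *m G) 0 j + (dmx j u *m G) 0 i =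
  (gnab u *m G + (gnab u *m G)^T) i j.
Proof.
have gnabGE a b : (gnab u *m G) a b =
  (dmx a u *m G) 0 b + \sum_k u 0 k * (Gam k *m G) a b.
  have -> : (gnab u *m G) a b = (nab a u *m G) 0 b by rewrite -(rowK (fun a =>
    nab a u) a) -row_mul [RHS]mxE.
  rewrite /nab mulmxDl addmxE -mulmxA; congr (_ + _); rewrite mxE.
  by apply: eq_bigr => k _; congr (_ * _); rewrite !mxE;
    apply: eq_bigr => l _; rewrite GamC.
rewrite addmxE [X in _ = _ + X]mxE !gnabGE.
have -> : \sum_k u 0 k * d k (G i j) =
  \sum_k u 0 k * (Gam k *m G) i j + \sum_k u 0 k * (Gam k *m G) j i.
  rewrite -big_split; apply: eq_bigr => k _ /=; rewrite -mulrDr; congr (_ * _).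
  have /matrixP/(_ i j) := nabG k; rewrite mxE addmxE => ->; congr (_ + _).
  by rewrite -[in LHS]G_sym -trmx_mul mxE.
ring.
Qed.

(** Differentiating g(xi, xi) = 1 gives twice this quantity. *)
Lemma nab_unit (xi : 'rV[F]_m) i : xi *m G *m xi^T =
  1%:M -> nab i xi *m G *m xi^T = 0.
Proof.
move=> u1; have := nab_inner i xi xi.
have -> : dmx i (xi *m G *m xi^T) = 0 by rewrite u1; apply/matrixP => a b;
  rewrite !mxE der_nat.
have -> : xi *m G *m (nab i xi)^T = (nab i xi *m G *m xi^T)^T.
  by rewrite !trmx_mul trmxK G_sym mulmxA.
move=> /esym/matrixP E; apply/matrixP => a b; rewrite zeromxE; apply: two_reg.
by move: (E a b); rewrite !ord1 addmxE [X in _ + X]mxE zeromxE.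
Qed.

(** * Curvature of a Kenmotsu metric in the direction of xi *)

Section Kenmotsu.
Variable xi : 'rV[F]_m.
Local Notation eta := (xi *m G).
Hypothesis xi_unit : eta *m xi^T = 1%:M.
Hypothesis nab_xi : forall i, nab i xi = e i - eta 0 i *: xi.

Lemma gnab_xi : gnab xi = 1%:M - eta^T *m xi.
Proof.
apply/row_matrixP => i; rewrite rowK nab_xi linearB /= row1 row_mul;
  congr (_ - _).
by apply/rowP => j; rewrite !mxE big_ord1 !mxE.
Qed.

Lemma div_xi : divg xi = m%:R - 1.
Proof.
by rewrite /divg gnab_xi raddfB /= mxtrace1 mxtrace_mulC -mxtrace_tr trmx_mul
   trmxK xi_unit mxtrace1.
Qed.

Lemma mul_delta_tr (u : 'rV[F]_m) j : (u *m (e j)^T) 0 0 = u 0 j.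
Proof. by rewrite trmx_delta -colE mxE. Qed.

Lemma der_eta i j :
  d i (eta 0 j) = G i j - eta 0 i * eta 0 j + (eta *m (row j (Gam i))^T) 0 0.
Proof.
have -> : d i (eta 0 j) = dmx i (eta *m (e j)^T) 0 0.
  by rewrite [RHS]mxE mul_delta_tr.
rewrite nab_inner nab_delta addmxE; congr (_ + _).
rewrite mul_delta_tr nab_xi mulmxDl mulNmxC -rowE -scalemxAl.
by rewrite addmxE oppmxE scalemxE [X in X - _]mxE.
Qed.

(** The form eta is closed: in [der_eta] each term is symmetric in [i] and [j], the last one by
    vanishing torsion. *)
Lemma der_eta_sym i j : d i (eta 0 j) = d j (eta 0 i).
Proof.
by rewrite !der_eta torsion_free -{1}G_sym mxE (mulrC (eta 0 i)).
Qed.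

(** The Ricci identity applied to nabla xi = I - eta (x) xi. The derivatives of eta cancel since eta
    is closed, those of the coordinate vectors by vanishing torsion. *)
Lemma xi_riem i j : xi *m riem i j = eta 0 i *: e j - eta 0 j *: e i.
Proof.
rewrite -ricci_identity !nab_xi !(nabD, nabN, nabZ) !nab_delta !nab_xi.
rewrite torsion_free der_eta_sym; mxentries.
Qed.

(* The endomorphism R(e_j, xi). *)
Definition xi_curv j : 'M[F]_m := \sum_k xi 0 k *: riem j k.

(** Pair symmetry moves xi from the argument of R, where [xi_riem] applies, to the second slot: R(X,
    xi)Z = g(X, Z) xi - eta(Z) X. *)
Lemma xi_curvE j : xi_curv j = G *m (e j)^T *m xi - eta^T *m e j.
Proof.
apply: mulG_inj; apply/matrixP => a b.
have -> : (xi_curv j *m G) a b = - (xi *m riem a b *m G) 0 j.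
  rewrite /xi_curv mulmx_suml summxE -mulmxA mxE -sumrN.
  apply: eq_bigr => k _.
  by rewrite -scalemxAl scalemxE (riem_pair j k a b) (riem_antiE a b k j) mulrN.
rewrite xi_riem !mulmxDl !mulNmxC -!scalemxAl -!rowE.
rewrite -!mulmxA -rowE trmx_delta mulmxA -colE.
rewrite !(addmxE, oppmxE, scalemxE) !mxE !big_ord1 !mxE.
by rewrite (GC b j); ring.
Qed.

Definition act {p q} (A : 'M[F]_(p, q)) : 'M[F]_(p, q)
  := \sum_k xi 0 k *: dmx k A.

Local Notation Gxi := (\sum_k xi 0 k *: Gam k).

Lemma der_xi i k : d i (xi 0 k) = (i == k)%:R - eta 0 i * xi 0 k - Gxi i k.
Proof.
have -> : d i (xi 0 k) = (nab i xi - xi *m Gam i) 0 k by rewrite /nab addrK mxE.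
rewrite nab_xi !(addmxE, oppmxE, scalemxE) mxE eqxx eq_sym; congr (_ - _ - _).
rewrite mxE summxE; apply: eq_bigr => l _; by rewrite scalemxE GamC.
Qed.

(** By the Leibniz rule, taking xi inside the derivative costs the curvature evaluated on d_i xi,
    which [der_xi] expands; the last sum is its Christoffel part. *)
Lemma nab_end_xi_riem i j :
  \sum_k xi 0 k *: nab_end i (riem j k) =
  nab_end i (xi_curv j) - riem j i + eta 0 i *: xi_curv j
  + \sum_k Gxi i k *: riem j k.
Proof.
have -> : nab_end i (xi_curv j) = \sum_k d i (xi 0 k) *: riem j k
    + \sum_k xi 0 k *: nab_end i (riem j k).
  rewrite nab_end_sum -big_split; apply: eq_bigr => k _; exact: nab_endZ.
have -> : \sum_k d i (xi 0 k) *: riem j k =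
    riem j i - eta 0 i *: xi_curv j - \sum_k Gxi i k *: riem j k.
  rewrite scaler_sumr.
  rewrite [X in _ = X - _ - _](_ : _ = \sum_k (i == k)%:R *: riem j k);
    last first.
    rewrite (bigD1 i)//= eqxx scale1r big1 ?addr0// => k.
    by rewrite eq_sym => /negPf->; rewrite scale0r.
  rewrite -!sumrB; apply: eq_bigr => k _.
  by rewrite der_xi !scalerBl scalerA.
mxentries.
Qed.

Lemma nab_end_xi_curv i j : nab_end i (xi_curv j) =
  G *m (row j (Gam i))^T *m xi + G *m (e j)^T *m e i - G *m (e i)^T *m e j
  - eta^T *m row j (Gam i)
  - eta 0 i *: xi_curv j.
Proof.
(* Metric compatibility makes [nab_end] differentiate the two vectors of a dyad separately;
   [xi_curvE] is a difference of two dyads. *)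
have dyad u v : nab_end i (G *m u^T *m v) =
    G *m (nab i u)^T *m v + G *m u^T *m nab i v.
  rewrite /nab_end /nab !dmxM nabG dmxT; mxdistr; mxentries.
rewrite xi_curvE trmx_mul G_sym.
rewrite nab_endD nab_endN !dyad !nab_delta nab_xi; mxdistr; mxentries.
Qed.

(* The second Bianchi identity contracted with xi; the two last sums would be
   absorbed by a covariant derivative acting also on the indices i and j. *)
Lemma nab_xi_riem i j :
  \sum_k xi 0 k *: nab_end k (riem i j) =
  - 2 *: (riem i j + G *m (e j)^T *m e i - G *m (e i)^T *m e j)
  + \sum_k (Gxi i k *: riem k j) + \sum_k (Gxi j k *: riem i k).
Proof.
have -> : \sum_k xi 0 k *: nab_end k (riem i j) =
    \sum_k xi 0 k *: nab_end j (riem i k)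
      - \sum_k xi 0 k *: nab_end i (riem j k).
  rewrite -sumrB; apply: eq_bigr => k _; rewrite -scalerBr; congr (_ *: _).
  rewrite (riemN k i) nab_endN; have := bianchi2 i j k; rewrite -addrA => /eqP.
  by rewrite addr_eq0 opprD addrC => /eqP.
rewrite !nab_end_xi_riem !nab_end_xi_curv (torsion_free i j) (riemN j i).
have -> : \sum_k Gxi i k *: riem k j = - \sum_k Gxi i k *: riem j k.
  by rewrite -sumrN; apply: eq_bigr => k _; rewrite riemN scalerN.
mxentries.
Qed.

Definition ric : 'M[F]_m := \matrix_(j, a) \sum_i riem i j a i.

(** The trace of [xi_riem] takes eta_j once from the diagonal and removes it [m] times; here 1 - m =
    -2n. *)
Lemma ric_xi : ric *m xi^T = (1 - m%:R) *: eta^T.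
Proof.
apply/matrixP => j z; rewrite ord1 scalemxE mxE.
under eq_bigr do rewrite !mxE mulr_suml.
rewrite exchange_big /=.
transitivity (\sum_i (xi *m riem i j) 0 i).
  by apply: eq_bigr => i _; rewrite mxE; apply: eq_bigr => k _; rewrite mulrC.
under eq_bigr do rewrite xi_riem addmxE oppmxE !scalemxE ![delta_mx _ _ _
  _]mxE !eqxx mulr1 /=.
rewrite sumrB sumr_const card_ord (bigD1 j)//= eqxx mulr1 big1; last first.
  by move=> k /negPf->; rewrite mulr0.
by rewrite [eta^T j 0]mxE -mulr_natr; ring.
Qed.

(** With the two [Gxi] terms moved to the left this is nabla_xi S = -2 S + 2 (1 - m) g, the trace of
    [nab_xi_riem]. *)
Lemma act_ric : act ric =
  - 2 *: ric + (2 * (1 - m%:R)) *: G + Gxi *m ric + ric *m Gxi^T.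
Proof.
apply/matrixP => j a.
have actE A : act A = \sum_k xi 0 k *: nab_end k A - A *m Gxi + Gxi *m A.
  rewrite mulmx_sumr mulmx_suml -sumrB -big_split; apply: eq_bigr => k _ /=.
  by rewrite /nab_end; mxdistr; mxentries.
have -> : act ric j a = \sum_i (act (riem i j)) a i.
  rewrite /act summxE; under [RHS]eq_bigr do rewrite summxE.
  rewrite exchange_big /=; apply: eq_bigr => k _.
  rewrite scalemxE 2!mxE der_sum mulr_sumr; apply: eq_bigr => i _.
  by rewrite scalemxE [dmx _ _ _ _]mxE.
have dyadE k l b : (G *m (e k)^T *m e l) a b = G a k * (b == l)%:R.
  by rewrite trmx_delta -colE mxE big_ord1 !mxE.
have T2 : \sum_i (G *m (e j)^T *m e i) a i = m%:R * G a j.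
  under eq_bigr do rewrite dyadE eqxx mulr1.
  by rewrite sumr_const card_ord mulr_natl.
have T3 : \sum_i (G *m (e i)^T *m e j) a i = G a j.
  rewrite (bigD1 j)//= big1 ?addr0 => [|i ij];
    first by rewrite dyadE eqxx mulr1.
  by rewrite dyadE (negPf ij) mulr0.
(* Only an exchange of the summed indices; the result cancels the term of [actE] in which [Gxi]
   multiplies on the right. *)
have T4 : \sum_i (\sum_k Gxi i k *: riem k j) a i =
  \sum_i (riem i j *m Gxi) a i.
  under eq_bigr do rewrite summxE.
  under [RHS]eq_bigr do rewrite mxE.
  rewrite exchange_big /=; apply: eq_bigr => k _; apply: eq_bigr => i _.
  by rewrite scalemxE mulrC.
have T5 : \sum_i (\sum_k Gxi j k *: riem i k) a i = (Gxi *m ric) j a.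
  under eq_bigr do rewrite summxE.
  rewrite exchange_big mxE /=; apply: eq_bigr => k _.
  by rewrite [ric _ _]mxE mulr_sumr; apply: eq_bigr => i _; rewrite scalemxE.
have T7 : \sum_i (Gxi *m riem i j) a i = (ric *m Gxi^T) j a.
  under eq_bigr do rewrite mxE.
  rewrite exchange_big mxE /=; apply: eq_bigr => k _.
  rewrite [ric _ _]mxE [_^T _ _]mxE mulr_suml; apply: eq_bigr => i _.
  by rewrite mulrC.
have E i : act (riem i j) a i =
    - 2 * (riem i j a i + (G *m (e j)^T *m e i) a i - (G *m (e i)^T *m e j) a i)
    + (\sum_k Gxi i k *: riem k j) a i + (\sum_k Gxi j k *: riem i k) a i
    - (riem i j *m Gxi) a i + (Gxi *m riem i j) a i.
  rewrite actE nab_xi_riem; move: (riem i j) => Rij.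
  by rewrite !(addmxE, oppmxE, scalemxE).
under eq_bigr do rewrite E.
rewrite !(big_split, sumrN, =^~ mulr_sumr) /= T2 T3 T4 T5 T7.
rewrite !(addmxE, oppmxE, scalemxE) [ric j a in RHS]mxE (GC j a).
ring.
Qed.

Lemma dmx_Gi k : dmx k Gi = - (Gi *m Gam k + (Gam k)^T *m Gi).
Proof.
have : dmx k (G *m Gi) = 0.
  by rewrite G_inv; apply/matrixP => a b; rewrite !mxE der_nat.
rewrite dmxM nabG mulmxDl -[_ *m G *m Gi]mulmxA G_inv mulmx1 =>
  /(congr1 (mulmx Gi)).
rewrite mulmx0; mxdistr; rewrite Gi_invl !mul1mx => /eqP.
by rewrite addrC addr_eq0 => /eqP.
Qed.

Definition along (X : 'rV[F]_m) (f : F) : F := \sum_k X 0 k * d k f.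

Definition scal : F := \tr (ric *m Gi).

(** The connection terms of [act_ric] cancel those of [dmx_Gi] under the trace, and tr (G Gi) = m
    supplies the constant, which is -4n(2n+1). *)
Lemma along_scal : along xi scal = - 2 * scal + 2 * (1 - m%:R) * m%:R.
Proof.
have -> : along xi scal = \tr (act (ric *m Gi)).
  rewrite /act raddf_sum; apply: eq_bigr => k _ /=.
  by rewrite mxtraceZ dmx_tr.
have -> : act (ric *m Gi) =
    act ric *m Gi - ric *m (Gi *m Gxi + Gxi^T *m Gi).
  rewrite /act (raddf_sum trmx) mulmx_suml [Gi *m _]mulmx_sumr mulmx_suml /=.
  rewrite -big_split mulmx_sumr -sumrB.
  apply: eq_bigr => k _ /=; rewrite dmxM dmx_Gi.
  by mxdistr; mxentries.
rewrite act_ric; mxdistr.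
rewrite G_inv.
rewrite !(mxtraceD, raddfN, mxtraceZ) /= mxtrace1.
rewrite -/scal.
have -> : \tr (Gxi *m ric *m Gi) = \tr (ric *m Gi *m Gxi).
  by rewrite -mulmxA mxtrace_mulC.
ring.
Qed.

(** * Lie brackets and divergence *)

Lemma alongD X f h : along X (f + h) = along X f + along X h.
Proof. by rewrite /along -big_split; apply: eq_bigr => k _;
  rewrite dD mulrDr. Qed.

Lemma alongM X f h : along X (f * h) = along X f * h + f * along X h.
Proof.
rewrite /along mulr_suml mulr_sumr -big_split.
by apply: eq_bigr => k _; rewrite dM /=; ring.
Qed.

Lemma along_cst X c : (forall i, d i c = 0) -> along X c = 0.
Proof. by move=> dc; rewrite /along big1// => k _; rewrite dc mulr0. Qed.

(** Written with the connection so that the known derivatives of xi can be substituted directly;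
    [lieE] recovers the coordinate bracket. *)
Definition lie (X Y : 'rV[F]_m) : 'rV[F]_m := X *m gnab Y - Y *m gnab X.

Lemma lieE X Y k : lie X Y 0 k = along X (Y 0 k) - along Y (X 0 k).
Proof.
have E U W : (U *m gnab W) 0 k = along U (W 0 k) +
  \sum_i \sum_j U 0 i * W 0 j * Gam i j k.
  rewrite mul_gnab summxE -big_split; apply: eq_bigr => i _.
  rewrite scalemxE addmxE mulrDr !mxE; congr (_ + _).
  by rewrite mulr_sumr; apply: eq_bigr => j _; rewrite mulrA.
rewrite addmxE oppmxE !E [X in _ - (_ + X)]exchange_big /=.
rewrite (eq_bigr (fun i => \sum_j Y 0 j * X 0 i * Gam j i k)); last first.
  by move=> i _; apply: eq_bigr => j _; rewrite GamC (mulrC (X 0 i)).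
ring.
Qed.

(** Here [\tr (Gam k)] stands for the k-th derivative of the logarithm of the volume density. *)
Lemma divgE X : divg X = \sum_k (d k (X 0 k) + X 0 k * \tr (Gam k)).
Proof.
rewrite big_split /=.
under [X in _ + X]eq_bigr do rewrite mulr_sumr.
rewrite exchange_big -big_split; apply: eq_bigr => k _ /=.
rewrite mxE addmxE !mxE; congr (_ + _).
by apply: eq_bigr => j _; rewrite GamC.
Qed.

(** An endomorphism that is skew for [G] has the opposite trace of itself. *)
Lemma tr_riem0 i j : \tr (riem i j) = 0.
Proof.
apply: two_reg; apply/eqP; rewrite addr_eq0; apply/eqP.
rewrite -{1}[riem i j]mulmx1 -G_inv mulmxA -mxtrace_tr trmx_mul riem_anti
  Gi_sym.
by rewrite mulmxNC raddfN /= mxtrace_mulC -mulmxA G_inv mulmx1.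
Qed.

(** In coordinates, second derivatives of the components match those of the bracket, products of
    first derivatives cancel by symmetry ([cross]), and the density terms cancel because the form
    [\tr (Gam k)] is closed. *)
Lemma divg_lie X Y : divg (lie X Y) = along X (divg Y) - along Y (divg X).
Proof.
have closed i k : d i (\tr (Gam k)) = d k (\tr (Gam i)).
  by apply/eqP; rewrite -subr_eq0 -tr_riem tr_riem0.
have E U W : along U (divg W) = \sum_k \sum_i
  (U 0 i * d k (d i (W 0 k)) + U 0 i * d i (W 0 k) * \tr (Gam k))
  + \sum_k \sum_i U 0 i * W 0 k * d i (\tr (Gam k)).
  rewrite divgE -big_split /along /=.
  under eq_bigr do rewrite der_sum mulr_sumr.
  rewrite exchange_big; apply: eq_bigr => k _.
  rewrite -big_split; apply: eq_bigr => i _.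
  by rewrite /= dD dM (dC i k); ring.
rewrite !E [X in _ - (_ + X)]exchange_big /=.
rewrite [X in _ - (_ + X)](_ : _ =
  \sum_k \sum_i X 0 i * Y 0 k * d i (\tr (Gam k))); last first.
  by apply: eq_bigr => k _; apply: eq_bigr => i _;
    rewrite closed (mulrC (Y 0 k)).
have cross : \sum_k \sum_i d k (X 0 i) * d i (Y 0 k) =
  \sum_k \sum_i d k (Y 0 i) * d i (X 0 k).
  rewrite exchange_big; apply: eq_bigr => k _; apply: eq_bigr => i _.
  by rewrite mulrC.
rewrite opprD addrACA subrr addr0.
apply/eqP; rewrite -subr_eq0; apply/eqP.
transitivity (\sum_k \sum_i d k (X 0 i) * d i (Y 0 k)
  - \sum_k \sum_i d k (Y 0 i) * d i (X 0 k)); last first.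
  by rewrite cross subrr.
rewrite divgE -!sumrB; apply: eq_bigr => k _ /=.
rewrite lieE /along derB !der_sum mulrBl !mulr_suml -!sumrB -big_split -sumrB.
by apply: eq_bigr => i _ /=; rewrite !dM; ring.
Qed.

Lemma divgD X Y : divg (X + Y) = divg X + divg Y.
Proof.
rewrite !divgE -big_split; apply: eq_bigr => k _.
by rewrite addmxE dD /=; ring.
Qed.

Lemma divgZ c X : (forall i, d i c = 0) -> divg (c *: X) = c * divg X.
Proof.
move=> dc; rewrite !divgE mulr_sumr; apply: eq_bigr => k _.
by rewrite scalemxE dM dc; ring.
Qed.

Definition differential (h : F) : 'rV[F]_m := \row_i d i h.

(** * The soliton equation *)

Section Soliton.
Variables (V : 'rV[F]_m) (c1 c2 kap : F).
Hypothesis der_c : forall i, [/\ d i c1 = 0, d i c2 = 0 & d i kap = 0].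
(** In the application c1 = 2 lambda - (p + 2/(2n+1)) and c2 = 2 mu, so this defines kappa with the
    denominator cleared. *)
Hypothesis kapE : c1 + c2 = 2 * (m%:R - 1 - kap).
Hypothesis soliton : gnab V *m G + (gnab V *m G)^T + 2 *: ric + c1 *: G
  + c2 *: (eta^T *m eta) = 0.

Local Notation f := ((V *m G *m xi^T) 0 0).
Local Notation df := (differential f).
Local Notation W := (df *m Gi).

(** Contraction of the soliton equation with xi: by [ric_xi] every term outside the Lie derivative
    is a multiple of eta, and the coefficients add up to -2 kappa. *)
Lemma soliton_xi :
  xi *m gnab V *m G = (2 * kap) *: eta - eta *m (gnab V)^T.
Proof.
have /(congr1 (fun A => (A *m xi^T)^T)) := soliton.
have exi : eta^T *m eta *m xi^T = eta^T by rewrite -mulmxA xi_unit mulmx1.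
rewrite !mulmxDl !mulZmx ric_xi exi mul0mx; mxdistr; rewrite G_sym trmx0 => E.
have c2E : c2 = 2 * (m%:R - 1 - kap) - c1 by rewrite -kapE; ring.
apply/eqP; rewrite -subr_eq0 -{}E c2E; apply/eqP.
mxentries.
Qed.

Lemma dfE : df = eta *m (gnab V)^T + V *m G - f *: eta.
Proof.
apply/rowP => i; rewrite mxE.
have -> : d i f = dmx i (V *m G *m xi^T) 0 0 by rewrite [RHS]mxE.
rewrite nab_inner nab_xi trmxD trmxN trmxZ mulmxDr mulmxNC mulmxZ.
rewrite !(addmxE, oppmxE, scalemxE) mul_delta_tr addrA (mulrC f).
congr (_ + _ - _).
have -> : nab i V = row i (gnab V) by rewrite rowK.
have -> : eta *m (gnab V)^T = (gnab V *m G *m xi^T)^T.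
  by rewrite !trmx_mul trmxK G_sym !mulmxA.
by rewrite -!row_mul !mxE.
Qed.

Lemma mul_xiT_scalar : V *m eta^T = f%:M.
Proof. by rewrite trmx_mul G_sym mulmxA [LHS]mx11_scalar. Qed.

Lemma WG : W *m G = df.
Proof. by rewrite -mulmxA Gi_invl mulmx1. Qed.

Lemma mul_gnab_xi (U : 'rV[F]_m) : U *m gnab xi = U - (U *m eta^T) *m xi.
Proof. by rewrite gnab_xi mulmxDr mulmx1 mulmxNC mulmxA. Qed.

(** After lowering the index, [dfE] trades the form g(nabla V, xi) of [soliton_xi] for df; the
    remaining terms in V and f xi cancel against nabla_V xi. *)
Lemma lie_xi_V : lie xi V = (2 * kap) *: xi - W.
Proof.
rewrite /lie mul_gnab_xi mul_xiT_scalar mul_scalar_mx.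
apply: mulG_inj; rewrite !(mulmxDl, mulNmxC) WG dfE soliton_xi !mulZmx.
mxentries.
Qed.

(** By [dfE], xi(f) = g(nabla_xi V, xi); by [soliton_xi] the same number equals 2 kappa minus
    itself. *)
Lemma df_xi : df *m xi^T = kap%:M.
Proof.
rewrite [LHS]mx11_scalar; congr (_%:M).
have E1 : (df *m xi^T) 0 0 = (eta *m (gnab V)^T *m xi^T) 0 0.
  rewrite dfE !mulmxDl mulNmxC mulZmx xi_unit !(addmxE, oppmxE, scalemxE)
    [1%:M _ _]mxE.
  by rewrite mulr1 addrK.
have := congr1 (fun A : 'rV_m => (A *m xi^T) 0 0) soliton_xi.
rewrite mulmxDl mulNmxC mulZmx xi_unit !(addmxE, oppmxE, scalemxE)
  [1%:M _ _]mxE mulr1.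
have -> : (xi *m gnab V *m G *m xi^T) 0 0 = (df *m xi^T) 0 0.
  rewrite E1 -[in RHS](trmxK (_ *m _ *m _)) [RHS]mxE.
  by rewrite !trmx_mul !trmxK G_sym !mulmxA.
rewrite -E1 => /eqP; rewrite eq_sym subr_eq => /eqP E.
by apply/eqP; rewrite -subr_eq0; apply/eqP/two_reg; move: E => /eqP;
  rewrite -subr_eq0 => /eqP E; rewrite -[RHS]oppr0 -E; ring.
Qed.

(** The Hessian of f is symmetric, so nabla_xi W is determined by g(nabla_i W, xi), and that follows
    by differentiating the constant g(W, xi) = kappa. *)
Lemma lie_xi_W : lie xi W = (2 * kap) *: xi - 2 *: W.
Proof.
have hessE i j : (nab i W *m G) 0 j =
  d i (d j f) - (df *m (row j (Gam i))^T) 0 0.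
  have : dmx i (W *m G *m (e j)^T) 0 0 =
    d i (d j f) by rewrite mxE mul_delta_tr WG [df _ _]mxE.
  rewrite nab_inner addmxE mul_delta_tr nab_delta WG => <-.
  by rewrite addrK.
have hessC i j : (nab i W *m G) 0 j = (nab j W *m G) 0 i.
  by rewrite !hessE dC torsion_free.
have xiW : xi *m gnab W *m G = kap *: eta - df.
  apply/rowP => i.
  transitivity ((nab i W *m G *m xi^T) 0 0).
    rewrite mul_gnab mulmx_suml summxE [RHS]mxE; apply: eq_bigr => k _.
    by rewrite mulZmx scalemxE hessC [xi^T _ _]mxE mulrC.
  have : dmx i (W *m G *m xi^T) 0 0 = 0 by rewrite WG df_xi !mxE mulr1n;
    case: (der_c i).
  rewrite nab_inner addmxE nab_xi trmxD trmxN trmxZ mulmxDr mulmxNC mulmxZ.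
  rewrite WG df_xi !(addmxE, oppmxE, scalemxE)
    mul_delta_tr [kap%:M _ _]mxE eqxx mulr1n.
  by move=> /eqP; rewrite addr_eq0 => /eqP ->; ring.
have We : W *m eta^T = kap%:M by rewrite trmx_mul G_sym mulmxA WG df_xi.
rewrite /lie mul_gnab_xi We mul_scalar_mx.
apply: mulG_inj; rewrite !(mulmxDl, mulNmxC) !mulZmx WG xiW.
mxentries.
Qed.

Lemma trace_soliton : 2 * divg V = - 2 * scal - c1 * m%:R - c2.
Proof.
have /(congr1 (fun A => \tr (A *m Gi))) := soliton.
rewrite !mulmxDl !mulZmx mul0mx mxtrace0 !(mxtraceD, mxtraceZ)
  G_inv mxtrace1 -/scal.
rewrite -(mulmxA _ G) G_inv mulmx1 -[\tr (_^T *m Gi)]mxtrace_tr trmx_mul trmxK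
  Gi_sym.
rewrite mxtrace_mulC -(mulmxA _ G) G_inv mulmx1 -/(divg V).
have -> : \tr (eta^T *m eta *m Gi) = 1.
  rewrite -mulmxA mxtrace_mulC -(mulmxA xi G) G_inv mulmx1 -mxtrace_tr trmx_mul.
  by rewrite trmxK xi_unit mxtrace1.
by move=> E; apply/eqP; rewrite -subr_eq0 -E; apply/eqP; ring.
Qed.

Lemma along_divg U : along xi (divg U) = divg (lie xi U).
Proof.
rewrite divg_lie div_xi (along_cst U) ?subr0// => i.
by rewrite derB der_nat der1 subr0.
Qed.

Lemma der_two i : d i 2 = 0.
Proof. exact: der_nat. Qed.

Lemma along_scale c h : (forall i, d i c = 0) -> along xi (c * h) =
  c * along xi h.
Proof. by move=> dc; rewrite alongM along_cst// mul0r add0r. Qed.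

Lemma soliton_constant : (m%:R - 1) * kap = 0.
Proof.
have d2k i : d i (2 * kap) = 0.
  by rewrite dM der_two; case: (der_c i) => _ _ ->; ring.
have dN1 i : d i (- 1) = 0 by rewrite derN der1 oppr0.
have dN2 i : d i (- 2) = 0 by rewrite derN der_two oppr0.
have divgW : along xi (divg W) = 2 * kap * (m%:R - 1) - 2 * divg W.
  rewrite along_divg lie_xi_W divgD -scaleNr (divgZ (2 * kap))// div_xi.
  by rewrite divgZ// mulNr.
have divgV : along xi (divg V) = 2 * kap * (m%:R - 1) - divg W.
  rewrite along_divg lie_xi_V divgD -scaleN1r (divgZ (2 * kap))// div_xi.
  by rewrite divgZ// mulN1r.
have E : 2 * along xi (divg V) = - 2 * along xi scal.
  rewrite -!along_scale//; last exact: der_two.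
  rewrite trace_soliton -!addrA alongD [X in _ + X]along_cst ?addr0// => i.
  case: (der_c i) => d1 d2 _.
  by rewrite !(dD, derN) dM d1 d2 der_nat; ring.
(* One derivative along xi of the traced soliton equation; [E3] is the second one. *)
have E2 : - 2 * divg W + 4 * kap * (m%:R - 1) =
  4 * scal - 4 * (1 - m%:R) * m%:R.
  move: E; rewrite divgV along_scal => E.
  transitivity (2 * (2 * kap * (m%:R - 1) - divg W)); first by ring.
  by rewrite E; ring.
have E3 : - 2 * along xi (divg W) = 4 * along xi scal.
  have d4 i : d i 4 = 0 := der_nat i 4.
  have dk i : d i (4 * kap * (m%:R - 1)) = 0.
    by rewrite !dM derB !der_nat der1; case: (der_c i) => _ _ ->; ring.
  have dm i : d i (- (4 * (1 - m%:R) * m%:R)) = 0.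
    by rewrite derN !dM derB !der_nat der1; ring.
  have := congr1 (along xi) E2.
  by rewrite !alongD (along_cst xi _ dk) (along_cst xi _ dm)
    !along_scale// !addr0.
move: E3; rewrite divgW along_scal => E3.
apply/two_reg/two_reg.
(* Adding twice [E2] to [E3] eliminates div W and the scalar curvature; what remains is 4 (m - 1)
   kappa. *)
transitivity (- 2 * (2 * kap * (m%:R - 1) - 2 * divg W)
  - 4 * (- 2 * scal + 2 * (1 - m%:R) * m%:R) + 2 * (- 2 * divg W +
    4 * kap * (m%:R - 1)
  - (4 * scal - 4 * (1 - m%:R) * m%:R))).
  ring.
by rewrite E3 E2 !subrr mulr0 addr0.
Qed.

End Soliton.
End Kenmotsu.

End Metric.
End Connection.
End DerivationRing.

(** * The Levi-Civita connection from the Christoffel symbols *)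

Section Christoffel.
Context {F : comPzRingType} {m : nat}.
Variables (d : 'I_m -> F -> F) (G Gi : 'M[F]_m) (half : F).
Hypothesis G_sym : G^T = G.
Hypothesis G_inv : G *m Gi = 1%:M.
Hypothesis halfE : half + half = 1.

Definition chris i j : 'rV[F]_m :=
  half *: ((\row_l (d i (G j l) + d j (G i l) - d l (G i j))) *m Gi).

Definition levi_civita i : 'M[F]_m := \matrix_j chris i j.

Let GC i j : G i j = G j i.
Proof. by rewrite -{1}G_sym mxE. Qed.

Lemma levi_civita_torsion i j : row j (levi_civita i) = row i (levi_civita j).
Proof.
rewrite !rowK; congr (_ *: (_ *m _)); apply/rowP => l.
by rewrite !mxE (GC i j) [X in X - _]addrC.
Qed.

(** With the index lowered, the symbol and its transpose share the derivative along [i]; their other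
    two derivatives have opposite signs. *)
Lemma levi_civita_metric i :
  dmx d i G = levi_civita i *m G + G *m (levi_civita i)^T.
Proof.
have E j k : (levi_civita i *m G) j k =
  half * (d i (G j k) + d j (G i k) - d k (G i j)).
  transitivity ((row j (levi_civita i) *m G) 0 k);
    first by rewrite -row_mul [RHS]mxE.
  by rewrite rowK /chris -scalemxAl -mulmxA (mulmx1C G_inv) mulmx1 !mxE.
apply/matrixP => j k; rewrite -[X in _ *m X^T]mulmx1.
have -> : G *m (levi_civita i *m 1%:M)^T = (levi_civita i *m G)^T.
  by rewrite mulmx1 trmx_mul G_sym.
rewrite addmxE [X in _ + X]mxE !E mxE (GC k j).
transitivity ((half + half) * d i (G j k)); last by ring.
by rewrite halfE mul1r.
Qed.

End Christoffel.

Set Implicit Arguments.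
Unset Strict Implicit.

(** * Smooth functions on an open set *)

Lemma near_eq_differentiable (R : realType) (V W : normedModType R)
    (f g : V -> W) (x : V) :
  {near x, f =1 g} -> differentiable f x -> differentiable g x.
Proof.
move=> fg df.
have gdf : g \o shift x = cst (g x) + 'd f x +o_ 0 id.
  apply/eqaddoP => e e0.
  have /eqaddoP/(_ e e0) fo := diff_locally df.
  have fg0 : \forall h \near (0 : V), f (h + x) = g (h + x).
    move: fg; rewrite (near_shift 0) /= subr0.
    by apply: filterS => h /=; rewrite addrC.
  apply: filterS2 fg0 fo => h fgh.
  have -> : (g \o shift x - (cst (g x) + 'd f x)) h =
    (f \o shift x - (cst (f x) + 'd f x)) h.
    by rewrite /= !fctE /= -fgh (nbhs_singleton fg).
  by [].
have E : 'd g x = 'd f x :> (V -> W) by apply: diff_unique gdf;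
  exact: diff_continuous.
by apply/diff_locallyP; rewrite E; split => //; exact: diff_continuous.
Qed.

(** * Mean value theorems along lines *)

Section Line.
Context {R : realType} {m : nat}.
Implicit Types (f : 'rV[R]_m -> R) (x u v y : 'rV[R]_m) (s t h : R).

Lemma is_derive_line f y u s : derivable f (s *: u + y) u ->
  is_derive s 1 (fun t => f (t *: u + y)) ('D_u f (s *: u + y)).
Proof.
move=> df.
have E : (fun h : R => h^-1 *: (((fun t => f (t *: u +
  y)) \o shift s) (h *: 1) - f (s *: u + y)))
   = (fun h : R => h^-1 *: ((f \o shift (s *: u + y)) (h *: u) - f (s *: u +
     y))).
  by apply/funext => h; rewrite /= scalerDl addrA -scalerA scale1r.
by split; rewrite /derivable /derive E.
Qed.

Lemma line_MVT f y u h : 0 < h ->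
  (forall s, 0 <= s <= h -> derivable f (s *: u + y) u) ->
  exists2 s, 0 <= s <= h & f (h *: u + y) - f y = h * 'D_u f (s *: u + y).
Proof.
move=> h0 df.
have dl s : s \in `]0, h[ -> is_derive s 1 (fun t => f (t *: u +
  y)) ('D_u f (s *: u + y)).
  by rewrite in_itv => /andP[s0 s1]; apply/is_derive_line/df; rewrite !ltW.
have [|s sh] := MVT h0 dl.
  apply: derivable_within_continuous => s; rewrite in_itv => /= sh.
  by have [] := is_derive_line (df s sh).
rewrite scale0r add0r subr0 mulrC => E; exists s => //.
by move: sh; rewrite in_itv /= => /andP[? ?]; rewrite !ltW.
Qed.

(** The mean value theorem is used twice: along [u] for the increment [F] of f in the direction h v,
    then along [v] for the derivative of f along [u]. *)
Lemma second_difference f x u v h : 0 < h ->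
  (forall s t, 0 <= s <= h -> 0 <= t <= h ->
    differentiable f (t *: v + (s *: u + x)) /\
    differentiable ('D_u f) (t *: v + (s *: u + x))) ->
  exists s t, [/\ 0 <= s <= h, 0 <= t <= h &
    f (h *: v + (h *: u + x)) - f (h *: v + x) - f (h *: u + x) + f x =
    h ^+ 2 * 'D_v ('D_u f) (t *: v + (s *: u + x))].
Proof.
move=> h0 df.
have zh : 0 <= (0 : R) <= h by apply/andP; split=> //; exact: ltW.
have hh : 0 <= h <= h by apply/andP; split=> //; exact: ltW.
pose F y := f (y + h *: v) - f y.
have shiftD y : derivable f (y + h *: v) u -> is_derive y u (fun z => f (z +
  h *: v)) ('D_u f (y + h *: v)).
  move=> dy.
  have E : (fun k : R => k^-1 *: (((fun z => f (z +
    h *: v)) \o shift y) (k *: u) - f (y + h *: v)))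
   = (fun k : R => k^-1 *: ((f \o shift (y + h *: v)) (k *: u) - f (y +
     h *: v))).
    by apply/funext => k; rewrite /= addrA.
  by split; rewrite /derivable /derive E.
have dF s : 0 <= s <= h -> is_derive (s *: u + x) u F ('D_u f (s *: u + x +
  h *: v) - 'D_u f (s *: u + x)).
  move=> sh; apply: is_deriveB.
    by apply/shiftD/diff_derivable; rewrite addrC; case: (df s h sh hh).
  by apply/derivableP/diff_derivable; have [] := df s 0 sh zh;
    rewrite scale0r add0r.
have [|s sh E1] := @line_MVT F x u h h0.
  by move=> s sh; have [] := dF s sh.
have [|t th E2] := @line_MVT ('D_u f) (s *: u + x) v h h0.
  by move=> t th; apply/diff_derivable; case: (df s t sh th).
exists s, t; split => //.
rewrite expr2 -mulrA -E2 addrC [h *: v + (s *: u + x)]addrC.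
have [_ <-] := dF s sh; rewrite -E1 /F.
by rewrite [h *: v + _]addrC [h *: v + x]addrC; ring.
Qed.

End Line.

(** * Calculus of C^k functions and symmetry of second derivatives *)

Section Smooth.
Context {R : realType} {m : nat}.
Implicit Types (U : set 'rV[R]_m).

Lemma near_open U x (P : 'rV[R]_m -> Prop) : open U -> U x ->
  (forall y, U y -> P y) -> \forall y \near x, P y.
Proof.
by move=> oU Ux UP; apply: filterS (open_nbhs_nbhs (conj oU Ux)).
Qed.

Lemma continuous_near_open U (W : normedModType R) (f g : 'rV[R]_m -> W) x :
  open U -> U x -> (forall y, U y -> f y = g y) ->
  {for x, continuous f} -> {for x, continuous g}.
Proof.
move=> oU Ux fg cf; rewrite /prop_for /continuous_at -fg//.
have nfg : {near x, f =1 g} := near_open oU Ux fg.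
exact: cvg_trans (near_eq_cvg nfg) cf.
Qed.

Lemma Ck_on_eq U (W : normedModType R) k (f g : 'rV[R]_m -> W) : open U ->
  (forall x, U x -> f x = g x) -> Ck_on k U f -> Ck_on k U g.
Proof.
move=> oU; elim: k f g => [|k IH] f g fg /=.
  by move=> cf x Ux; apply: continuous_near_open fg (cf x Ux).
move=> [df Cf]; split=> [x Ux|v].
  by apply: near_eq_differentiable (df x Ux); exact: (near_open oU Ux fg).
by apply: IH (Cf v) => x Ux; apply: near_eq_derive; exact: (near_open oU Ux fg).
Qed.

Lemma Ck_onS U (W : normedModType R) k (f : 'rV[R]_m -> W) :
  Ck_on k.+1 U f -> Ck_on k U f.
Proof.
elim: k f => [|k IH] f [df Cf]; first by move=> x /df/differentiable_continuous.
by split=> // v; exact/IH/Cf.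
Qed.

Lemma Ck_on_cst U (W : normedModType R) k (c : W) : Ck_on k U (fun=> c).
Proof.
elim: k c => [|k IH] c /=; first by move=> x _; exact: cst_continuous.
split=> [x _|v]; first exact: differentiable_cst.
suff -> : (fun x : 'rV[R]_m => 'D_v (fun=> c) x) = fun=> (0 : W) by exact: IH.
by apply/funext => x; exact: derive_cst.
Qed.

Lemma Ck_onD U k (f g : 'rV[R]_m -> R) : open U ->
  Ck_on k U f -> Ck_on k U g -> Ck_on k U (fun x => f x + g x).
Proof.
move=> oU; elim: k f g => [|k IH] f g /=.
  by move=> cf cg x Ux; exact: continuousD (cf x Ux) (cg x Ux).
move=> [df Cf] [dg Cg]; split=> [x Ux|v].
  by apply: differentiableD; [exact: df|exact: dg].
apply: Ck_on_eq (IH _ _ (Cf v) (Cg v)) => // x Ux.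
by rewrite -[RHS]/('D_v (f + g) x) deriveD//; apply/diff_derivable;
  [exact: df|exact: dg].
Qed.

Lemma Ck_onM U k (f g : 'rV[R]_m -> R) : open U ->
  Ck_on k U f -> Ck_on k U g -> Ck_on k U (fun x => f x * g x).
Proof.
move=> oU; elim: k f g => [|k IH] f g.
  by move=> cf cg x Ux; exact: continuousM (cf x Ux) (cg x Ux).
(* The Leibniz rule also needs f and g themselves at order [k], hence the lowered copies. *)
move=> Cf' Cg'; move: (Ck_onS Cf') (Ck_onS Cg') => fk gk.
move: Cf' Cg' => [df Cf] [dg Cg]; split=> [x Ux|v].
  by apply: differentiableM; [exact: df|exact: dg].
apply: Ck_on_eq (Ck_onD oU (IH _ _ fk (Cg v)) (IH _ _ gk (Cf v))) => // x Ux.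
by rewrite -[RHS]/('D_v (f * g) x) deriveM//; apply/diff_derivable;
  [exact: df|exact: dg].
Qed.

Lemma Ck_onV U k (f : 'rV[R]_m -> R) : open U -> (forall x, U x -> f x != 0) ->
  Ck_on k U f -> Ck_on k U (fun x => (f x)^-1).
Proof.
move=> oU f0; elim: k f f0 => [|k IH] f f0.
  by move=> cf x Ux; exact: continuousV (f0 x Ux) (cf x Ux).
move=> Cf'; have fk := Ck_onS Cf'; move: Cf' => [df Cf]; split=> [x Ux|v].
  by apply: differentiableV; [exact: df|exact: f0].
have fV := IH f f0 fk.
apply: Ck_on_eq (Ck_onM oU (Ck_on_cst _ _ (- 1 : R))
  (Ck_onM oU (Ck_onM oU fV fV) (Cf v))) => // x Ux.
rewrite (deriveV (f0 x Ux)); last exact/diff_derivable/df.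
by rewrite scaleNr mulN1r expr2 invfM.
Qed.

Lemma Ck_on_entry U k p q (f : 'rV[R]_m -> 'M[R]_(p, q)) i j : open U ->
  Ck_on k U f -> Ck_on k U (fun x => f x i j).
Proof.
move=> oU; elim: k f => [|k IH] f.
  by move=> cf x Ux; apply: (@continuous_comp _ _ _ f (fun A : 'M[R]_(p, q) =>
    A i j) x (cf x Ux));
     exact: coord_continuous.
move=> [df Cf]; split=> [x Ux|v].
  by apply: (@differentiable_comp _ _ _ _ f (fun A : 'M[R]_(p, q) =>
    A i j) x (df x Ux));
     exact: differentiable_coord.
apply: Ck_on_eq (IH _ (Cf v)) => // x Ux.
by rewrite derive_mx ?mxE//; exact/diff_derivable/df.
Qed.

(** One second difference is h^2 times either mixed derivative, each taken at some point close to
    [x]; continuity of both at [x] then forces equality. *)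
Lemma deriveC U (f : 'rV[R]_m -> R) x u v : open U -> Ck_on 2 U f -> U x ->
  'D_v ('D_u f) x = 'D_u ('D_v f) x.
Proof.
move=> oU [df Cf] Ux.
have dd w y : U y -> differentiable ('D_w f) y by have [dfw _] := Cf w;
  exact: dfw.
have cc w w' y : U y -> {for y, continuous ('D_w ('D_w' f))}.
  by have [_] := Cf w'; apply.
apply/eqP/contraT => ne.
(* Half of the supposed gap, so that two errors below [e] cannot bridge it. *)
pose e := `|'D_v ('D_u f) x - 'D_u ('D_v f) x| / 2.
have e0 : 0 < e by rewrite divr_gt0// normr_gt0 subr_eq0.
have : \forall y \near x, [/\ U y, `|'D_v ('D_u f) x - 'D_v ('D_u f) y| < e
   & `|'D_u ('D_v f) x - 'D_u ('D_v f) y| < e].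
  have /cvgrPdist_lt/(_ e e0) n1 := cc v u x Ux.
  have /cvgrPdist_lt/(_ e e0) n2 := cc u v x Ux.
  have n3 := open_nbhs_nbhs (conj oU Ux).
  apply: filterS (filterI n3 (filterI n1 n2)) => y [Uy [y1 y2]]; split.
  - exact: Uy.
  - exact: y1.
  - exact: y2.
move=> /nbhs_ballP[r /= r0 B].
(* Steps up to [h] along [u] and [v] stay inside the ball; the summand 1 keeps the bound strict and
   the denominator positive when both vectors vanish. *)
pose h := r / (1 + `|u| + `|v|).
have h0 : 0 < h by rewrite divr_gt0// -addrA ltr_pwDl// addr_ge0.
have rE : r = h * (1 + `|u| + `|v|).
  by rewrite divfK// gt_eqF// -addrA ltr_pwDl// addr_ge0.
clearbody h.
have inB s t : 0 <= s <= h -> 0 <= t <= h -> ball x r (t *: v + (s *: u + x)).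
  move=> /andP[s0 sh] /andP[t0 th].
  rewrite -ball_normE /= distrC addrA addrK (le_lt_trans (ler_normD _ _))//
    !normrZ.
  rewrite !ger0_norm//.
  apply: (@le_lt_trans _ _ (h * `|v| + h * `|u|));
    first by rewrite lerD// ler_wpM2r.
  by rewrite rE addrC !mulrDr mulr1 -[ltRHS]addrA ltrDr.
have [|s [t [sh th E1]]] := @second_difference _ _ f x u v h h0.
  by move=> s t sh th; have [Uy _ _] := B _ (inB s t sh th); split;
    [exact: df|exact: dd].
have [|t' [s' [th' sh' E2]]] := @second_difference _ _ f x v u h h0.
  move=> t' s' th' sh'.
  have -> : s' *: u + (t' *: v + x) = t' *: v + (s' *: u + x) by rewrite addrCA.
  have [Uy _ _] := B _ (inB s' t' sh' th'); split; [exact: df|exact: dd].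
have eqD : 'D_v ('D_u f) (t *: v + (s *: u + x)) =
  'D_u ('D_v f) (s' *: u + (t' *: v + x)).
  apply: (@mulfI _ (h ^+ 2)); first by rewrite expf_neq0// gt_eqF.
  apply: etrans (esym E1) (etrans _ E2).
  rewrite [h *: u + (h *: v + x)]addrCA; congr (_ + _); exact: addrAC.
have [_ B1 _] := B _ (inB s t sh th).
have [_ _] := B _ (inB s' t' sh' th'); rewrite addrCA -eqD => B2.
have := ler_distD ('D_v ('D_u f) (t *: v + (s *: u +
  x))) ('D_v ('D_u f) x) ('D_u ('D_v f) x).
rewrite [X in _ <= _ + X]distrC leNgt => /negP[].
by apply: lt_le_trans (ltrD B1 B2) _; rewrite -splitr.
Qed.

End Smooth.

(** * The ring of smooth functions on an open set *)

Record open_domain (R : realType) (m : nat) := OpenDomain {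
  odset : set 'rV[R]_m ;
  odset_open : open odset }.
Arguments odset_open {R m} o.

Section SmoothRing.
Context {R : realType} {m : nat} (D : open_domain R m).

Local Notation U := (odset D).

(* Functions vanish outside U, so that equality on U is equality; the unit of
   the ring is thus the indicator function of U. *)
Definition smooth0 : {pred ('rV[R]_m -> R)} :=
  fun f => `[< smooth_on U f /\ forall x, ~ U x -> f x = 0 >].

Record smoothfun := Smoothfun {
  sf_val :> 'rV[R]_m -> R ;
  sf_prop : sf_val \in smooth0 }.

HB.instance Definition _ := [isSub for sf_val].
HB.instance Definition _ := [Choice of smoothfun by <:].

Lemma smooth0P (f : 'rV[R]_m -> R)
  : reflect (smooth_on U f /\ forall x, ~ U x -> f x = 0) (f \in smooth0).
Proof. exact: asboolP. Qed.

Lemma smooth_onM (f g : 'rV[R]_m -> R) : smooth_on U f -> smooth_on U g ->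
  smooth_on U (fun x => f x * g x).
Proof. by move=> sf sg k; exact: (Ck_onM (odset_open D) (sf k) (sg k)). Qed.

Lemma smooth_cst (c : R) : smooth_on U (fun=> c).
Proof. by move=> k; exact: Ck_on_cst. Qed.

Lemma smooth0_zmod : zmod_closed smooth0.
Proof.
split; first by apply/smooth0P; split=> //; exact: (smooth_cst 0).
move=> f g /smooth0P[sf f0] /smooth0P[sg g0]; apply/smooth0P; split=> [k|x Dx].
  apply: (Ck_onD (odset_open D) (sf k)).
  have := Ck_onM (odset_open D) (Ck_on_cst _ k (- 1 : R)) (sg k).
  by apply: (Ck_on_eq (odset_open D)) => x _; rewrite mulN1r.
by rewrite /= !fctE f0// g0// subr0.
Qed.

HB.instance Definition _ := GRing.isZmodClosed.Build _ smooth0 smooth0_zmod.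
HB.instance Definition _ := [SubChoice_isSubZmodule of smoothfun by <:].

Definition cutoff (f : 'rV[R]_m -> R) : 'rV[R]_m -> R :=
  fun x => if `[< U x >] then f x else 0.

Lemma cutoffE f x : U x -> cutoff f x = f x.
Proof. by rewrite /cutoff; case: asboolP. Qed.

Lemma cutoff_out f x : ~ U x -> cutoff f x = 0.
Proof. by rewrite /cutoff; case: asboolP. Qed.

Lemma smooth0_cutoff (f : 'rV[R]_m -> R) : smooth_on U f ->
  cutoff f \in smooth0.
Proof.
move=> sf; apply/smooth0P; split=> [k|x]; last exact: cutoff_out.
by apply: Ck_on_eq (sf k) => [|x Dx]; [exact: odset_open|rewrite cutoffE].
Qed.

Definition smooth_of (f : 'rV[R]_m ->
  R) (sf : smooth_on U f) : smoothfun := Smoothfun (smooth0_cutoff sf).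

Lemma sf_smooth (f : smoothfun) : smooth_on U f.
Proof. by have /smooth0P[] := sf_prop f. Qed.

Lemma sf_out (f : smoothfun) x : ~ U x -> f x = 0.
Proof. by have /smooth0P[_] := sf_prop f; apply. Qed.

Lemma sf_eq (f g : smoothfun) : (forall x, U x -> f x = g x) -> f = g.
Proof.
move=> fg; apply/val_inj/funext => x /=.
by have [Dx|Dx] := pselect (U x); [exact: fg|rewrite !sf_out].
Qed.

Definition sf_one : smoothfun := smooth_of (smooth_cst 1).
Definition sf_mul (f g : smoothfun)
  : smoothfun := smooth_of (smooth_onM (sf_smooth f) (sf_smooth g)).

Lemma sf_mulE (f g : smoothfun) x : U x -> sf_mul f g x = f x * g x.
Proof. exact: cutoffE. Qed.

Lemma sf_oneE x : U x -> sf_one x = 1.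
Proof. exact: cutoffE. Qed.

Lemma sf_addE (f g : smoothfun) x : (f + g) x = f x + g x.
Proof. by []. Qed.

Lemma sf_oppE (f : smoothfun) x : (- f) x = - f x.
Proof. by []. Qed.

Lemma sf_mulA : associative sf_mul.
Proof. by move=> f g h; apply: sf_eq => x Dx; rewrite !sf_mulE// mulrA. Qed.

Lemma sf_mulC : commutative sf_mul.
Proof. by move=> f g; apply: sf_eq => x Dx; rewrite !sf_mulE// mulrC. Qed.

Lemma sf_mul1 : left_id sf_one sf_mul.
Proof. by move=> f; apply: sf_eq => x Dx;
  rewrite !sf_mulE// sf_oneE// mul1r. Qed.

Lemma sf_mulDl : left_distributive sf_mul +%R.
Proof. by move=> f g h; apply: sf_eq => x Dx;
  rewrite sf_addE !sf_mulE// sf_addE mulrDl. Qed.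

HB.instance Definition _ :=
  GRing.Zmodule_isComPzRing.Build smoothfun sf_mulA sf_mulC sf_mul1 sf_mulDl.

Lemma sf_der_smooth v (f : smoothfun) : smooth_on U ('D_v f).
Proof. by move=> k; have [_ Cf] := sf_smooth f k.+1; exact: Cf. Qed.

Definition sf_der (i : 'I_m) (f : smoothfun) : smoothfun :=
  smooth_of (sf_der_smooth (coord_vec i) f).

Lemma sf_derE i f x : U x -> sf_der i f x = 'D_(coord_vec i) f x.
Proof. exact: cutoffE. Qed.

Lemma sf_differentiable (f : smoothfun) x : U x -> differentiable f x.
Proof. by move=> Dx; have [df _] := sf_smooth f 1; exact: df. Qed.

Lemma sf_derivable (f : smoothfun) v x : U x -> derivable f x v.
Proof. by move=> Dx; exact/diff_derivable/sf_differentiable. Qed.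

Lemma eq_on_derive (W : normedModType R) (f g : 'rV[R]_m -> W) v x : U x ->
  (forall y, U y -> f y = g y) -> 'D_v f x = 'D_v g x.
Proof.
by move=> Dx fg; apply: near_eq_derive; exact: (near_open (odset_open D) Dx fg).
Qed.

Lemma sf_derD i (f g : smoothfun) : sf_der i (f + g) = sf_der i f + sf_der i g.
Proof.
apply: sf_eq => x Dx; rewrite sf_addE !sf_derE//.
by rewrite -[LHS]/('D_(coord_vec i) (sf_val f + sf_val g) x) deriveD//;
  exact: sf_derivable.
Qed.

Lemma sf_derM i (f g : smoothfun) : sf_der i (f * g) =
  sf_der i f * g + f * sf_der i g.
Proof.
apply: sf_eq => x Dx; rewrite sf_addE !sf_mulE// !sf_derE//.
rewrite (@eq_on_derive _ _ (sf_val f * sf_val g))//; last first.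
  by move=> y Dy; rewrite sf_mulE.
rewrite (deriveM (@sf_derivable f _ _ Dx) (@sf_derivable g _ _ Dx)) addrC.
by congr (_ + _); exact: mulrC.
Qed.

Lemma sf_derC i j (f : smoothfun) : sf_der i (sf_der j f) =
  sf_der j (sf_der i f).
Proof.
apply: sf_eq => x Dx.
have E a b : sf_der a (sf_der b f) x = 'D_(coord_vec a) ('D_(coord_vec b) f) x.
  apply: etrans (sf_derE _ _ Dx) _.
  by apply: eq_on_derive => // y Dy; exact: sf_derE.
apply: etrans (E i j) (etrans _ (esym (E j i))).
exact: (deriveC _ _ (odset_open D) (sf_smooth f 2) Dx).
Qed.

Lemma sf_two_reg (f : smoothfun) : f + f = 0 -> f = 0.
Proof.
move=> ff; apply: sf_eq => x Dx;
  have /(congr1 (fun h : smoothfun => h x)) := ff.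
by rewrite sf_addE => /eqP; rewrite -mulr2n mulrn_eq0 /= => /eqP.
Qed.

Section Eval.
Variable x : {x | U x}.

(** The point is taken in U because elsewhere the unit of the ring evaluates to 0, and evaluation
    would not be a ring morphism. *)
Definition sf_ev (f : smoothfun) : R := f (sval x).

Lemma sf_ev_zmod : zmod_morphism sf_ev.
Proof. by []. Qed.

Lemma sf_ev_monoid : monoid_morphism sf_ev.
Proof. by split=> [|f g]; [exact: sf_oneE (svalP x)|exact: sf_mulE (svalP x)].
  Qed.

HB.instance Definition _ := GRing.isZmodMorphism.Build smoothfun R sf_ev
  sf_ev_zmod.
HB.instance Definition _ := GRing.isMonoidMorphism.Build smoothfun R sf_ev
  sf_ev_monoid.

End Eval.
End SmoothRing.

(** * Coordinate domains *)

Lemma submxE (F : comPzRingType) p q (A B : 'M[F]_(p, q)) i j :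
  (A - B) i j = A i j - B i j.
Proof. by rewrite !mxE. Qed.

Section Bridge.
Context {R : realType} {m : nat} (D : open_domain R m).
Local Notation U := (odset D).
Local Notation F := (smoothfun D).
Local Notation d := (@sf_der R m D).
Local Notation e j := (delta_mx (0 : 'I_1) j).

Definition const (c : R) : F := smooth_of (smooth_cst D c).

Lemma smooth_ofE (f : 'rV[R]_m -> R) (sf : smooth_on U f) x :
  U x -> smooth_of sf x = f x.
Proof. exact: cutoffE. Qed.

Lemma constE c x : U x -> const c x = c.
Proof. exact: cutoffE. Qed.

Lemma der_const c i : d i (const c) = 0.
Proof.
apply: sf_eq => x Ux; apply: etrans (sf_derE _ _ Ux) _.
apply: etrans (@eq_on_derive _ _ D _ (const c) (fun=> c) _ _ Ux _) _.
  by move=> y; exact: constE.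
exact: derive_cst.
Qed.

Lemma sf_sumE I (r : seq I) (P : pred I) (f : I -> F) x :
  (\sum_(i <- r | P i) f i) x = \sum_(i <- r | P i) f i x.
Proof. by apply: (big_morph (fun h : F => h x)). Qed.

Lemma sf_natE k x : U x -> (k%:R : F) x = k%:R.
Proof. by move=> Ux; exact: (rmorph_nat (sf_ev (exist _ x Ux))). Qed.

Lemma mx_smooth p q (f : 'rV[R]_m -> 'M[R]_(p, q)) i j :
  smooth_on U f -> smooth_on U (fun x => f x i j).
Proof. by move=> sf k; exact: (Ck_on_entry _ _ (odset_open D) (sf k)). Qed.

Definition mx_of p q (f : 'rV[R]_m ->
  'M[R]_(p, q)) (sf : smooth_on U f) : 'M[F]_(p, q) :=
  \matrix_(i, j) smooth_of (mx_smooth i j sf).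

Lemma mx_ofE p q (f : 'rV[R]_m -> 'M[R]_(p, q)) (sf : smooth_on U f) i j x :
  U x -> mx_of sf i j x = f x i j.
Proof. by move=> Ux; rewrite mxE; exact: cutoffE. Qed.

Definition evmx p q (A : 'M[F]_(p, q)) x : 'M[R]_(p, q) := \matrix_(i, j)
  A i j x.

Lemma evmxM p q r (A : 'M[F]_(p, q)) (B : 'M[F]_(q, r)) x : U x ->
  evmx (A *m B) x = evmx A x *m evmx B x.
Proof.
move=> Ux; apply/matrixP => i j; rewrite !mxE sf_sumE; apply: eq_bigr => k _.
by rewrite sf_mulE// !mxE.
Qed.

Lemma evmxT p q (A : 'M[F]_(p, q)) x : evmx A^T x = (evmx A x)^T.
Proof. by apply/matrixP => i j; rewrite !mxE. Qed.

Lemma evmx_of p q (f : 'rV[R]_m -> 'M[R]_(p, q)) (sf : smooth_on U f) x : U x ->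
  evmx (mx_of sf) x = f x.
Proof. by move=> Ux; apply/matrixP => i j; rewrite mxE mx_ofE. Qed.

Lemma evmx_eq p q (A B : 'M[F]_(p, q)) :
  (forall x, U x -> evmx A x = evmx B x) -> A = B.
Proof.
move=> AB; apply/matrixP => i j; apply: sf_eq => x Ux.
by have /matrixP/(_ i j) := AB x Ux; rewrite !mxE.
Qed.

(** Agreement is asked on U only: [Y] may be arbitrary elsewhere, while the entries of [Yf] vanish
    there. *)
Definition represents (Yf : 'rV[F]_m) (Y : 'rV[R]_m -> 'rV[R]_m) :=
  forall y, U y -> forall k, Y y 0 k = Yf 0 k y.

Lemma represents_derivable Yf Y v x : represents Yf Y -> U x -> derivable Y x v.
Proof.
move=> YY Ux; apply/derivable_mxP => i k; rewrite ord1.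
apply: (@near_eq_derivable _ _ _ (Yf 0 k)); last exact: sf_derivable.
by apply: (near_open (odset_open D) Ux) => y Uy; rewrite YY.
Qed.

Lemma represents_derive Yf Y v x k : represents Yf Y -> U x ->
  ('D_v Y x) 0 k = 'D_v (Yf 0 k) x.
Proof.
move=> YY Ux; rewrite derive_mx ?mxE; last exact: represents_derivable YY Ux.
exact: (@eq_on_derive _ _ D _ (fun y => Y y 0 k) (Yf 0 k) v x Ux (fun y Uy =>
  YY y Uy k)).
Qed.

Lemma represents_derive_coord Yf Y i : represents Yf Y ->
  represents (dmx d i Yf) (fun x => 'D_(coord_vec i) Y x).
Proof.
move=> YY x Ux k; apply: etrans (represents_derive _ _ YY Ux) _.
by rewrite mxE; exact: esym (sf_derE _ _ Ux).
Qed.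

Lemma represents_coord j : represents (e j) (fun=> coord_vec j).
Proof. by move=> y Uy k; rewrite !mxE sf_natE. Qed.

(** * The metric, connection and Ricci tensor of a chart *)

Section Metric.
Variables (g : 'rV[R]_m -> 'M[R]_m) (sg : smooth_on U g).
Hypothesis g_sym : forall x, U x -> (g x)^T = g x.
Hypothesis g_pos : forall x, U x ->
  forall u : 'rV[R]_m, u != 0 -> 0 < (u *m g x *m u^T) 0 0.

Local Notation G := (mx_of sg).

Lemma G_symm : G^T = G.
Proof.
apply/matrixP => i j; rewrite mxE; apply: sf_eq => x Ux.
by rewrite !mx_ofE// -{1}g_sym// mxE.
Qed.

Lemma det_g_neq0 x : U x -> \det (g x) != 0.
Proof.
move=> Ux; apply/negP => /det0P[u u0 ug].
by have := g_pos Ux u0; rewrite ug mul0mx mxE ltxx.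
Qed.

Lemma det_GE x : U x -> (\det G) x = \det (g x).
Proof.
move=> Ux; rewrite -[LHS]/(sf_ev (exist _ x Ux) (\det G)) -det_map_mx.
by congr (\det _); apply/matrixP => i j; rewrite mxE; exact: mx_ofE.
Qed.

Lemma inv_det_smooth : smooth_on U (fun x => ((\det G) x)^-1).
Proof.
move=> k; apply: (Ck_onV (odset_open D)); last exact: sf_smooth.
by move=> x Ux; rewrite det_GE// det_g_neq0.
Qed.

(** Cramer's rule keeps the inverse inside the ring of smooth functions: only the inverse of the
    determinant has to be shown smooth. *)
Definition inv_metric : 'M[F]_m := smooth_of inv_det_smooth *: \adj G.
Local Notation Gi := inv_metric.

Lemma G_invr : G *m Gi = 1%:M.
Proof.
rewrite -scalemxAr mul_mx_adj scale_scalar_mx; congr (_%:M).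
apply: sf_eq => x Ux; rewrite sf_mulE// sf_oneE// smooth_ofE// mulVf//.
by rewrite det_GE// det_g_neq0.
Qed.

Lemma inv_metricE x i j : U x -> Gi i j x = invmx (g x) i j.
Proof.
move=> Ux; pose ev := sf_ev (exist _ x Ux).
have E : g x *m map_mx ev Gi = 1%:M.
  have -> : g x = map_mx ev G by apply/matrixP => a b; rewrite [RHS]mxE;
    exact: esym (mx_ofE _ _ _ Ux).
  by rewrite -map_mxM G_invr map_mx1.
have [ug _] := mulmx1_unit E.
by rewrite -[invmx _]mulmx1 -E mulKmx// [RHS]mxE.
Qed.

Local Notation Gam := (levi_civita d G Gi (const 2^-1)).

Lemma half_half : const 2^-1 + const 2^-1 = 1 :> F.
Proof.
apply: sf_eq => x Ux; rewrite sf_addE !constE//.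
by rewrite -mulr2n -[RHS](@mulfV _ 2)// mulr_natl.
Qed.

Lemma dmetricE i j k x : U x -> dmetric g i j k x = d i (G j k) x.
Proof.
move=> Ux; apply: etrans _ (esym (sf_derE _ _ Ux)).
by apply: (@eq_on_derive _ _ D _ (fun y => g y j k) (G j k) _ x Ux) => y Uy;
  rewrite mx_ofE.
Qed.

Lemma christoffelE i j k x : U x -> christoffel g i j x 0 k = Gam i j k x.
Proof.
move=> Ux; have -> : Gam i j k = chris d G Gi (const 2^-1)
  i j 0 k by rewrite mxE.
rewrite /chris !scalemxE sf_mulE// constE//; congr (_ * _).
rewrite [LHS]mxE [X in sf_val X]mxE sf_sumE; apply: eq_bigr => l _.
rewrite sf_mulE// inv_metricE//; congr (_ * _).
rewrite [LHS]mxE [X in sf_val X]mxE sf_addE sf_oppE sf_addE.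
by rewrite (dmetricE i j l Ux) (dmetricE j i l Ux) (dmetricE l i j Ux).
Qed.

Lemma represents_nabla i Yf Y : represents Yf Y ->
  represents (nab d Gam i Yf) (nabla g (fun=> coord_vec i) Y).
Proof.
move=> YY x Ux k; rewrite !addmxE sf_addE; congr (_ + _).
  exact: (represents_derive_coord i YY Ux k).
rewrite summxE (bigD1 i)//= [X in _ + X]big1 ?addr0 => [|a ai].
  rewrite summxE [X in sf_val X]mxE sf_sumE; apply: eq_bigr => j _.
  by rewrite scalemxE [coord_vec i 0 i]mxE !eqxx mul1r (YY x Ux)
    sf_mulE// christoffelE.
rewrite summxE big1// => j _.
by rewrite scalemxE [coord_vec i 0 a]mxE eqxx (negPf ai) !mul0r.
Qed.

Lemma nabla0_coord k x : nabla g (fun=> 0) (fun=> coord_vec k) x = 0.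
Proof.
rewrite /nabla derive0 add0r big1// => i _; rewrite big1// => j _.
by rewrite mxE mul0r scale0r.
Qed.

(** Coordinate fields commute, so the bracket term vanishes and the Ricci identity on e_k identifies
    the rest. *)
Lemma curvatureE i j k x : U x ->
  curvature g (fun=> coord_vec i) (fun=> coord_vec j) (fun=> coord_vec k) x =
  \row_l (riem d Gam i j k l) x.
Proof.
move=> Ux; have rk := represents_coord k.
rewrite /curvature.
rewrite (_ : lie_bracket _ _ = fun=> 0); last first.
  by apply/funext => y; rewrite /lie_bracket !derive_cst subrr.
rewrite nabla0_coord subr0; apply/rowP => l.
have E : (nab d Gam i (nab d Gam j (e k)) - nab d Gam j (nab d Gam i (e k)))
  0 l =
    riem d Gam i j k l.
  rewrite (ricci_identity d (@sf_derD _ _ D) (@sf_derM _ _ D) (@sf_derC _ _ D)).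
  by rewrite -rowE [LHS]mxE.
rewrite [RHS]mxE -E [X in sf_val X]submxE submxE sf_addE sf_oppE.
by congr (_ - _); [exact: (represents_nabla i (represents_nabla j rk) Ux l)
  |exact: (represents_nabla j (represents_nabla i rk) Ux l)].
Qed.

Lemma ricciE j k x : U x ->
  ricci g (fun=> coord_vec j) (fun=> coord_vec k) x = ric d Gam j k x.
Proof.
move=> Ux; rewrite [X in _ = sf_val X _]mxE sf_sumE; apply: eq_bigr => i _.
by rewrite curvatureE// mxE.
Qed.

Lemma derive_dir (f : F) (v : 'rV[R]_m) x : U x ->
  'D_v f x = \sum_k v 0 k * d k f x.
Proof.
move=> Ux; have df := sf_differentiable f Ux.
rewrite deriveE// {1}[v]row_sum_delta linear_sum; apply: eq_bigr => k _.
apply: etrans (linearZ _ _) _; congr (_ * _).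
exact: etrans (esym (deriveE _ df)) (esym (sf_derE k f Ux)).
Qed.

Lemma inner_coord (A : 'M[R]_m) (u : 'rV[R]_m) j : inner A u (coord_vec j) =
  (u *m A) 0 j.
Proof. exact: mul_delta_tr. Qed.

Lemma LC_torsion i j : row j (Gam i) = row i (Gam j).
Proof. exact: levi_civita_torsion G_symm _ _. Qed.

Lemma LC_metric i : dmx d i G = Gam i *m G + G *m (Gam i)^T.
Proof. exact: (levi_civita_metric d G Gi _ G_symm G_invr half_half). Qed.

(** For coordinate fields the bracket [V, e_k] is -d_k V, which turns the invariant definition into
    the formula of [lie_metric_nab]. *)
Lemma lie_metricE Vf V i j x : represents Vf V -> U x ->
  lie_metric g V (fun=> coord_vec i) (fun=> coord_vec j) x =
  (gnab d Gam Vf *m G + (gnab d Gam Vf *m G)^T) i j x.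
Proof.
move=> VV Ux.
have bracket k : lie_bracket V (fun=> coord_vec k) x = - 'D_(coord_vec k) V x.
  by rewrite /lie_bracket derive_cst sub0r.
have dVg k l : (dmx d k Vf *m G) 0 l x = ('D_(coord_vec k) V x *m g x) 0 l.
  rewrite mxE [RHS]mxE sf_sumE; apply: eq_bigr => a _.
  by rewrite sf_mulE// mx_ofE// (represents_derive_coord k VV Ux).
have dG : 'D_(V x) (fun y => inner (g y) (coord_vec i) (coord_vec j)) x =
    (\sum_k Vf 0 k * d k (G i j)) x.
  apply: etrans (@eq_on_derive _ _ D _ _ (G i j) _ _ Ux _) _.
    by move=> y Uy; rewrite inner_coord -rowE mxE mx_ofE.
  rewrite derive_dir// sf_sumE; apply: eq_bigr => k _.
  by rewrite (VV x Ux) sf_mulE.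
rewrite -(lie_metric_nab d Gam LC_torsion G G_symm LC_metric).
rewrite !sf_addE !dVg -dG /lie_metric !bracket; congr (_ + _ + _).
  by rewrite inner_coord mulNmx oppmxE opprK.
rewrite /inner linearN /= mulmxN oppmxE opprK.
by rewrite -[in LHS](g_sym Ux) -mulmxA -trmx_mul -rowE !mxE.
Qed.

(** * From the Kenmotsu condition to the derivative of xi *)

Section Kenmotsu.
Variables (phi : 'rV[R]_m -> 'M[R]_m) (xi : 'rV[R]_m -> 'rV[R]_m)
  (eta : 'rV[R]_m -> 'cV[R]_m).
Hypothesis s_xi : smooth_on U xi.
Hypothesis phi2 : forall x, U x -> forall u : 'rV[R]_m,
  u *m phi x *m phi x = - u + pairing (eta x) u *: xi x.
Hypothesis eta_xi : forall x, U x -> pairing (eta x) (xi x) = 1.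
Hypothesis etaE : forall x, U x -> forall u, pairing (eta x) u =
  inner (g x) u (xi x).
Hypothesis compat : forall x, U x -> forall u v : 'rV[R]_m,
  inner (g x) (u *m phi x) (v *m phi x) =
  inner (g x) u v - pairing (eta x) u * pairing (eta x) v.
Hypothesis nabla_phi : forall i x, U x ->
  nabla_endo g phi (fun=> coord_vec i) xi x =
  inner (g x) (coord_vec i *m phi x) (xi x) *: xi x
  - pairing (eta x) (xi x) *: (coord_vec i *m phi x).

(** By compatibility the squared length of phi xi is 1 - 1 = 0. *)
Lemma xi_phi x : U x -> xi x *m phi x = 0.
Proof.
move=> Ux; apply/eqP/contraT => /(g_pos Ux).
rewrite -[X in _ < X]/(inner (g x) (xi x *m phi x) (xi x *m phi x)) compat//.
by rewrite -etaE// eta_xi// mulr1 subrr ltxx.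
Qed.

Lemma pairingZ (w : 'cV[R]_m) c (u : 'rV[R]_m) : pairing w (c *: u) =
  c * pairing w u.
Proof. by rewrite /pairing -scalemxAl mxE. Qed.

(** Computing phi^3 u in two ways gives eta(phi u) xi = 0, as phi xi = 0. *)
Lemma eta_phi x u : U x -> pairing (eta x) (u *m phi x) = 0.
Proof.
move=> Ux; have := phi2 Ux (u *m phi x).
rewrite (phi2 Ux u) mulmxDl mulNmx -scalemxAl xi_phi// scaler0 => /addrI /esym.
move=> /(congr1 (pairing (eta x))); rewrite pairingZ eta_xi// mulr1 => ->.
by rewrite /pairing mul0mx mxE.
Qed.

(** The Kenmotsu condition with Y = xi reads phi(nabla_X xi) = phi X; applying phi once more
    recovers nabla_X xi up to its xi-component. *)
Lemma nabla_xi i x : U x -> let w := nabla g (fun=> coord_vec i) xi x in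
  w = coord_vec i - pairing (eta x) (coord_vec i) *: xi x +
    pairing (eta x) w *: xi x.
Proof.
move=> Ux w.
have r0 : represents 0 (fun y => xi y *m phi y).
  by move=> y Uy k; rewrite xi_phi// !mxE.
have wphi : w *m phi x = coord_vec i *m phi x.
  have := nabla_phi i Ux; rewrite /nabla_endo -/w -etaE// eta_phi// eta_xi//
    scale0r scale1r.
  have -> : nabla g (fun=> coord_vec i) (fun y => xi y *m phi y) x = 0.
    apply/rowP => k; apply: etrans (represents_nabla i r0 Ux k) _.
    by rewrite /nab mul0mx addr0 (dmx0 d (@sf_derD _ _ D)) !mxE.
  by rewrite !sub0r => /oppr_inj.
have := phi2 Ux w; rewrite wphi phi2// => E.
by rewrite -[LHS]opprK -[- w](addrK (pairing (eta x) w *: xi x))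
  -E !opprD !opprK.
Qed.

Local Notation Xi := (mx_of s_xi).

Lemma Xi_unit : Xi *m G *m Xi^T = 1%:M.
Proof.
apply: evmx_eq => x Ux; rewrite !evmxM// evmxT !evmx_of//.
apply/matrixP => a b; rewrite !ord1 -[LHS]/(inner (g x) (xi x) (xi x))
  -etaE// eta_xi//.
by rewrite !mxE sf_oneE.
Qed.

Lemma XiGE j x : U x -> (Xi *m G) 0 j x = pairing (eta x) (coord_vec j).
Proof.
move=> Ux; have -> : (Xi *m G) 0 j x =
  (evmx (Xi *m G) x) 0 j by rewrite [RHS]mxE.
rewrite evmxM// !evmx_of// etaE// /inner -[X in _ *m X *m _](g_sym Ux)
  -mulmxA -trmx_mul.
by rewrite -rowE !mxE.
Qed.

(** Unit length of xi ([nab_unit]) removes the xi-component that [nabla_xi] leaves open. *)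
Lemma nab_Xi i : nab d Gam i Xi = e i - (Xi *m G) 0 i *: Xi.
Proof.
have rXi : represents Xi xi by move=> y Uy k; rewrite mx_ofE.
have U0 := nab_unit d (@sf_derD _ _ D) (@sf_derM _ _ D) Gam G G_symm LC_metric
  (@sf_two_reg _ _ D) Xi i Xi_unit.
apply/rowP => k; apply: sf_eq => x Ux.
have wE : nabla g (fun=> coord_vec i) xi x = evmx (nab d Gam i Xi) x.
  by apply/rowP => l; rewrite [RHS]mxE; exact: (represents_nabla i rXi Ux l).
have w0 : pairing (eta x) (nabla g (fun=> coord_vec i) xi x) = 0.
  rewrite etaE// wE /inner -{1}(evmx_of sg Ux) -{1}(evmx_of s_xi Ux)
    -evmxT -!evmxM// U0.
  by rewrite !mxE.
rewrite -(represents_nabla i rXi Ux k) (nabla_xi i Ux) w0 scale0r addr0.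
rewrite [X in sf_val X]submxE sf_addE sf_oppE submxE; congr (_ - _).
  exact: represents_coord Ux k.
by rewrite !scalemxE sf_mulE// XiGE// mx_ofE.
Qed.

Lemma chart_soliton (V : 'rV[R]_m ->
  'rV[R]_m) (sV : smooth_on U V) (c1 c2 : R) (x0 : 'rV[R]_m) :
  U x0 ->
  (forall i j x, U x ->
    lie_metric g V (fun=> coord_vec i) (fun=> coord_vec j) x
    + 2 * ricci g (fun=> coord_vec i) (fun=> coord_vec j) x
    + c1 * inner (g x) (coord_vec i) (coord_vec j)
    + c2 * (pairing (eta x) (coord_vec i) * pairing (eta x) (coord_vec j)) =
      0) ->
  (m%:R - 1) * (m%:R - 1 - (c1 + c2) / 2) = 0.
Proof.
move=> Ux0 sol.
pose kap := m%:R - 1 - (c1 + c2) / 2.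
have rV : represents (mx_of sV) V by move=> y Uy k; rewrite mx_ofE.
have := soliton_constant d (@sf_derD _ _ D) (@sf_derM _ _ D) (@sf_derC _ _ D)
  Gam
  LC_torsion G Gi G_symm G_invr LC_metric (@sf_two_reg _ _ D) Xi Xi_unit nab_Xi
  (mx_of sV) (const c1) (const c2) (const kap).
(* Equality in the ring becomes equality of real numbers at [x0], where constants evaluate to
   themselves because [x0] lies in U. *)
move=> /(_ _ _ _)/(congr1 (fun f : F => f x0)).
have sfB (f h : F) x : (f - h) x = f x - h x by [].
rewrite sf_mulE// sfB sf_natE// sf_oneE// constE//; apply.
- by move=> i; rewrite !der_const.
- apply: sf_eq => x Ux; rewrite sf_mulE// !sfB sf_addE !constE// !sf_natE//.
  by rewrite /kap; field.
- apply/matrixP => i j; apply: sf_eq => x Ux.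
  have := sol i j x Ux; rewrite (lie_metricE i j rV Ux)
    ricciE// inner_coord -rowE.
  rewrite !addmxE !sf_addE !scalemxE !sf_mulE// !constE// sf_natE//.
  have -> : ((Xi *m G)^T *m (Xi *m G)) i j x =
    pairing (eta x) (coord_vec i) * pairing (eta x) (coord_vec j).
    by rewrite mxE big_ord1 sf_mulE// [(_^T) i _]mxE !XiGE.
  by rewrite mx_ofE// [row _ _ _ _]mxE [X in _ = sf_val X _]mxE.
Qed.

End Kenmotsu.
End Metric.
End Bridge.

Theorem theorem3p2 (R : realType) (n : nat) (n_ge1 : (1 <= n)%N)
    (M : smooth_manifold R (2 * n).+1)
    (g : riemannian_metric M) (phi : endo_field M) (xi : vector_field M)
    (eta : one_form M) (V : vector_field M) (lambda mu p : R) :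
  kenmotsu g phi xi eta ->
  conformal_eta_ricci_soliton g eta V lambda mu p ->
  [/\ mu < (2 * n)%:R + (p / 2 + 1 / (2 * n).+1%:R) -> shrinking lambda,
      mu = (2 * n)%:R + (p / 2 + 1 / (2 * n).+1%:R) -> steady lambda
    & mu > (2 * n)%:R + (p / 2 + 1 / (2 * n).+1%:R) -> expanding lambda].
Proof.
move=> [acm ken] sol.
have [q _] := manifold_nonempty M.
have [a aq] := atlas_cover q.
pose D := OpenDomain (@chart_img_open _ _ _ (atlas (s:=M) a)).
have cst_smooth c :
    smooth_on (chart_img (atlas (s:=M) a)) (fun=> c : 'rV[R]_(2 * n).+1).
  by move=> k; exact: Ck_on_cst.
have Ux0 : odset D (chart_coord (atlas (s:=M) a) q) by exists q.
have := @chart_soliton R _ D (g a) (rm_smooth g a) (@rm_sym _ _ _ g a)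
  (@rm_pos _ _ _ g a)
  (phi a) (xi a) (eta a) (vf_smooth xi a) (@acm_phi2 _ _ _ _ _ _ _ acm a)
  (@acm_eta_xi _ _ _ _ _ _ _ acm a) (@acm_eta _ _ _ _ _ _ _ acm a)
  (@acm_compatible _ _ _ _ _ _ _ acm a) _ (V a) (vf_smooth V a)
  (2 * lambda - (p + 2 / (2 * n).+1%:R)) (2 * mu) _ Ux0.
move=> /(_ (fun i x Ux => ken a _ _ (cst_smooth _) (vf_smooth xi a) x Ux))
  /(_ (fun i j x Ux => sol a _ _ (cst_smooth _) (cst_smooth _) x Ux)).
(* The dimension is m = 2n + 1, so the factor m - 1 is 2n, nonzero by [n_ge1]. *)
rewrite -[X in X%:R - 1]addn1 natrD addrK => /eqP;
  rewrite mulf_eq0 => /orP[|/eqP E].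
  by rewrite pnatr_eq0 muln_eq0 /= eqn0Ngt n_ge1.
have lambdaE : lambda = (2 * n)%:R + (p / 2 + 1 / (2 * n).+1%:R) - mu.
  (* Once the inverse of 2n + 1 is generalised to [t], the identity is linear. *)
  move: E; move: (_.+1%:R^-1) => t E; lra.
by rewrite /shrinking /steady /expanding lambdaE subr_gt0 subr_lt0;
  split => // ->; rewrite subrr.
Qed.
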